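(* Let $G=\prod_{n=1}^{\infty}\mathbb{Z}/2\mathbb{Z}$, let $B=\bigotimes_{k=1}^{\infty}M_{3^k}$, let $\gamma\colon\mathbb Z/2\mathbb Z\to\operatorname{Aut}(B)$ be the action generated by the order two automorphism $\nu=\bigotimes_{k=1}^\infty\operatorname{Ad}(w_k)$ (with $w_k\in M_{3^k}$ the unitary described in the context), let $A=\bigotimes_{n=1}^{\infty}B$, and let $\alpha\colon G\to\operatorname{Aut}(A)$ be the infinite tensor product of countably many copies of $\gamma$. Then $\alpha$ has the tracial Rokhlin property with comparison and the strong modified tracial Rokhlin property, using the same choices of $p\in A$ and $\varphi\colon C(G)\to pAp$; that is, for all finite $F\subseteq A$ and $S\subseteq C(G)$, every $\varepsilon>0$, every $x\in A_+$ with $\|x\|=1$, and every $y\in(A^\alpha)_+\setminus\{0\}$, there are a projection $p\in A^\alpha$, a unital completely positive map $\varphi\colon C(G)\to pAp$, and a partial isometry $s\in A^\alpha$ such that $p,\varphi$ satisfy the conditions in the definition of the tracial Rokhlin property with comparison for $F,S,\varepsilon,x,y$, and $p,\varphi,s$ satisfy the conditions in the definition of the strong modified tracial Rokhlin property for $F,S,\varepsilon,x$.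
   Context: For $k\in\mathbb N=\{1,2,\ldots\}$ set $r(k)=\tfrac12(3^k-1)$, and let $w_k\in M_{3^k}$ be the block unitary $$w_k=\begin{pmatrix}0&1_{M_{r(k)}}&0\\1_{M_{r(k)}}&0&0\\0&0&1_{\mathbb C}\end{pmatrix}.$$ The infinite tensor product action $\alpha$ is the unique continuous action with $\alpha_{(g_1,g_2,\ldots)}(b_1\otimes\cdots\otimes b_n\otimes1)=\gamma_{g_1}(b_1)\otimes\cdots\otimes\gamma_{g_n}(b_n)\otimes1$ for all $n\in\mathbb N$, $g_k\in\mathbb Z/2\mathbb Z$, $b_k\in B$. For a C*-algebra $C$ and $a,b\in C_+$ (positive elements), $a\precsim_Cb$ means $a$ is Cuntz subequivalent to $b$ in $C$. $A^\alpha$ is the fixed point algebra, and $\mathtt{Lt}_g(f)(h)=f(g^{-1}h)$ on $C(G)$. Let $A$ be an infinite dimensional simple separable unital C*-algebra and $\alpha$ an action on $A$ of a second countable compact group $G$. For a projection $p\in A^\alpha$, finite $F\subseteq A$, $S\subseteq C(G)$ and $\varepsilon>0$, a unital completely positive map $\varphi\colon C(G)\to pAp$ is $(F,S,\varepsilon)$-approximately equivariant central multiplicative if $\|\varphi(f_1f_2)-\varphi(f_1)\varphi(f_2)\|<\varepsilon$ for $f_1,f_2\in S$, $\|\varphi(f)a-a\varphi(f)\|<\varepsilon$ for $f\in S$, $a\in F$, and $\sup_{g\in G}\|\varphi(\mathtt{Lt}_g(f))-\alpha_g(\varphi(f))\|<\varepsilon$ for $f\in S$. Tracial Rokhlin property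 with comparison: for all finite $F\subseteq A$, $S\subseteq C(G)$, every $\varepsilon>0$, every $x\in A_+$ with $\|x\|=1$, and every $y\in(A^\alpha)_+\setminus\{0\}$, there are a projection $p\in A^\alpha$ and a unital completely positive $\varphi\colon C(G)\to pAp$ such that: (1) $\varphi$ is $(F,S,\varepsilon)$-approximately equivariant central multiplicative; (2) $1-p\precsim_Ax$; (3) $1-p\precsim_{A^\alpha}y$; (4) $1-p\precsim_{A^\alpha}p$; (5) $\|pxp\|>1-\varepsilon$. Strong modified tracial Rokhlin property: for all finite $F\subseteq A$, $S\subseteq C(G)$, every $\varepsilon>0$, and every $x\in A_+$ with $\|x\|=1$, there are a partial isometry $s\in A^\alpha$, a projection $p\in A^\alpha$ and a unital completely positive $\varphi\colon C(G)\to pAp$ such that: (1) $\varphi$ is $(F,S,\varepsilon)$-approximately equivariant central multiplicative; (2) $1-p\precsim_Ax$; (3) $s^*s=1-p$ and $ss^*\le p$; (4) $\|sa-as\|<\varepsilon$ for all $a\in F$; (5) $\|pxp\|>1-\varepsilon$. *)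

(* Defs.v *)
From HB Require Import structures.
From mathcomp Require Import all_boot all_order all_algebra.
From mathcomp Require Import complex.
From mathcomp Require Import all_classical all_reals all_analysis.
Set Implicit Arguments.
Unset Strict Implicit.
Unset Printing Implicit Defensive.
Import Order.TTheory GRing.Theory Num.Theory numFieldNormedType.Exports.
Local Open Scope classical_set_scope.
Local Open Scope ring_scope.
Local Open Scope complex_scope.

HB.mixin Record isStarAlgebra (R : realType) A of GRing.Algebra R[i] A := {
  star : A -> A;
  starD : {morph star : x y / x + y};
  starZ : forall (c : R[i]) x, star (c *: x) = c^* *: star x;
  starM : forall x y, star (x * y) = star y * star x;
  starK : involutive star
}.

#[short(type="starAlgType")]
HB.structure Definition StarAlgebra (R : realType) :=
  {A of GRing.Algebra R[i] A & isStarAlgebra R A}.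

(* The norm is a field of the mixin, with values in R, because the join of    *)
(* NormedModule with the ring structures is not available in the hierarchy.   *)
HB.mixin Record isCStarAlgebra (R : realType) A of StarAlgebra R A := {
  cnorm : A -> R;
  cnorm_triangle : forall x y, cnorm (x + y) <= cnorm x + cnorm y;
  cnormZ : forall (c : R[i]) x, cnorm (c *: x) = complex.Re `|c| * cnorm x;
  cnorm_eq0 : forall x, cnorm x = 0 -> x = 0;
  cnormM : forall x y, cnorm (x * y) <= cnorm x * cnorm y;
  cnorm_star : forall x, cnorm (star x * x) = cnorm x ^+ 2;
  cnorm_complete : forall u : nat -> A,
    (forall e : R, 0 < e -> exists N, forall m n, (N <= m)%N -> (N <= n)%N ->
       cnorm (u m - u n) < e) ->
    exists l, cnorm (u n - l) @[n --> \oo] --> (0 : R)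
}.

#[short(type="cstarType")]
HB.structure Definition CStarAlgebra (R : realType) :=
  {A of StarAlgebra R A & isCStarAlgebra R A}.

HB.mixin Record isTopologicalGroup G of Topological G & Group G := {
  mulg_continuous : continuous (fun xy : G * G => (xy.1 * xy.2)%g);
  invg_continuous : continuous (fun x : G => x^-1%g)
}.

#[short(type="topologicalGroupType")]
HB.structure Definition TopologicalGroup :=
  {G of Topological G & Group G & isTopologicalGroup G}.

Section MatrixStarAlgebra.
Variables (R : realType) (n : nat).
Implicit Types X Y : 'M[R[i]]_n.+1.

Definition mx_adjoint X : 'M[R[i]]_n.+1 := (map_mx Num.conj X)^T.

Lemma mx_adjointD : {morph mx_adjoint : X Y / X + Y}.
Proof. by move=> X Y; apply/matrixP => i j; rewrite !mxE rmorphD. Qed.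

Lemma mx_adjointZ (c : R[i]) X : mx_adjoint (c *: X) = c^* *: mx_adjoint X.
Proof. by apply/matrixP => i j; rewrite !mxE rmorphM. Qed.

Lemma mx_adjointM X Y : mx_adjoint (X * Y) = mx_adjoint Y * mx_adjoint X.
Proof.
apply/matrixP => i j; rewrite !mxE rmorph_sum; apply: eq_bigr => k _.
by rewrite !mxE rmorphM mulrC.
Qed.

Lemma mx_adjointK : involutive mx_adjoint.
Proof. by move=> X; apply/matrixP => i j; rewrite !mxE conjCK. Qed.

HB.instance Definition _ := isStarAlgebra.Build R 'M[R[i]]_n.+1
  mx_adjointD mx_adjointZ mx_adjointM mx_adjointK.
End MatrixStarAlgebra.

(* The topology of the scalars is the one carried by R[i]^o. *)
Definition contC (R : realType) (G : topologicalGroupType) : Type :=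
  continuousType G R[i]^o.

Section ContC.
Variables (R : realType) (G : topologicalGroupType).
Implicit Types f g h : contC R G.

HB.instance Definition _ := Choice.copy (contC R G) (continuousType G R[i]^o).

Definition contC_fun f : G -> R[i] := f : continuousType G R[i]^o.
Coercion contC_fun : contC >-> Funclass.

Definition contC_mk (f : G -> R[i]) (cf : continuous (f : G -> R[i]^o)) :
  contC R G := mkcts cf : continuousType G R[i]^o.

Lemma contCP f g : f =1 g -> f = g.
Proof. by move=> fg; apply/continuousEP. Qed.

Lemma contC_cont f : continuous (contC_fun f : G -> R[i]^o).
Proof. exact: cts_fun. Qed.

Lemma contC_cst_cont (c : R[i]) : continuous ((fun=> c) : G -> R[i]^o).
Proof. by move=> x; exact: cvg_cst. Qed.

Lemma contC_add_cont f g : continuous ((fun x => f x + g x) : G -> R[i]^o).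
Proof. by move=> x; apply: (@cvgD _ R[i]^o); exact: contC_cont. Qed.

Lemma contC_opp_cont f : continuous ((fun x => - f x) : G -> R[i]^o).
Proof. by move=> x; apply: (@cvgN _ R[i]^o); exact: contC_cont. Qed.

Lemma contC_mul_cont f g : continuous ((fun x => f x * g x) : G -> R[i]^o).
Proof. by move=> x; apply: (@cvgM R[i]); exact: contC_cont. Qed.

Lemma contC_conj_cont f : continuous ((fun x => (f x)^*) : G -> R[i]^o).
Proof.
move=> x; apply/(@cvgrPdist_lt _ R[i]^o) => e e0.
have /(@cvgrPdist_lt _ R[i]^o)/(_ e e0) := @contC_cont f x.
by apply: filterS => y; rewrite -rmorphB norm_conjC.
Qed.

Lemma contC_translate_cont (a : G) f :
  continuous ((fun x => f (a^-1 * x)%g) : G -> R[i]^o).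
Proof.
move=> x; apply: (@continuous_comp _ _ _ (fun y : G => (a^-1 * y)%g)
  (contC_fun f : G -> R[i]^o)); last exact: contC_cont.
have := @mulg_continuous G (a^-1%g, x).
move=> /(continuous_comp _); apply.
by apply: cvg_pair => /=; [exact: cvg_cst | exact: cvg_id].
Qed.

Definition contC_zero := contC_mk (@contC_cst_cont 0).
Definition contC_one := contC_mk (@contC_cst_cont 1).
Definition contC_add f g := contC_mk (@contC_add_cont f g).
Definition contC_opp f := contC_mk (@contC_opp_cont f).
Definition contC_mul f g := contC_mk (@contC_mul_cont f g).
Definition contC_scale (c : R[i]) f := contC_mul (contC_mk (@contC_cst_cont c)) f.
Definition contC_conj f := contC_mk (@contC_conj_cont f).
Definition Lt (a : G) f := contC_mk (@contC_translate_cont a f).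

Lemma contC_addA : associative contC_add.
Proof. by move=> f g h; apply: contCP => x /=; exact: addrA. Qed.
Lemma contC_addC : commutative contC_add.
Proof. by move=> f g; apply: contCP => x /=; exact: addrC. Qed.
Lemma contC_add0 : left_id contC_zero contC_add.
Proof. by move=> f; apply: contCP => x /=; exact: add0r. Qed.
Lemma contC_addN : left_inverse contC_zero contC_opp contC_add.
Proof. by move=> f; apply: contCP => x /=; exact: addNr. Qed.

HB.instance Definition _ := GRing.isZmodule.Build (contC R G)
  contC_addA contC_addC contC_add0 contC_addN.

Lemma contC_mulA : associative contC_mul.
Proof. by move=> f g h; apply: contCP => x /=; exact: mulrA. Qed.
Lemma contC_mul1 : left_id contC_one contC_mul.
Proof. by move=> f; apply: contCP => x /=; exact: mul1r. Qed.
Lemma contC_mulr1 : right_id contC_one contC_mul.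
Proof. by move=> f; apply: contCP => x /=; exact: mulr1. Qed.
Lemma contC_mulDl : left_distributive contC_mul +%R.
Proof. by move=> f g h; apply: contCP => x /=; exact: mulrDl. Qed.
Lemma contC_mulDr : right_distributive contC_mul +%R.
Proof. by move=> f g h; apply: contCP => x /=; exact: mulrDr. Qed.
Lemma contC_oner_neq0 : contC_one != 0.
Proof.
apply/eqP => /(congr1 (fun f : contC R G => f 1%g)) /= /eqP.
by apply/negP; exact: oner_neq0.
Qed.

HB.instance Definition _ := GRing.Zmodule_isNzRing.Build (contC R G)
  contC_mulA contC_mul1 contC_mulr1 contC_mulDl contC_mulDr contC_oner_neq0.

Lemma contC_scaleA a b f :
  contC_scale a (contC_scale b f) = contC_scale (a * b) f.
Proof. by apply: contCP => x /=; exact: mulrA. Qed.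
Lemma contC_scale1 : left_id 1 contC_scale.
Proof. by move=> f; apply: contCP => x /=; exact: mul1r. Qed.
Lemma contC_scaleDr : right_distributive contC_scale +%R.
Proof. by move=> a f g; apply: contCP => x /=; exact: mulrDr. Qed.
Lemma contC_scaleDl f : {morph contC_scale^~ f : a b / a + b}.
Proof. by move=> a b; apply: contCP => x /=; exact: mulrDl. Qed.

HB.instance Definition _ := GRing.Zmodule_isLmodule.Build R[i] (contC R G)
  contC_scaleA contC_scale1 contC_scaleDr contC_scaleDl.

Lemma contC_scaleAl a f g : a *: (f * g) = (a *: f) * g.
Proof. by apply: contCP => x /=; exact: mulrA. Qed.
HB.instance Definition _ := GRing.Lmodule_isLalgebra.Build R[i] (contC R G)
  contC_scaleAl.

Lemma contC_scaleAr a f g : a *: (f * g) = f * (a *: g).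
Proof. by apply: contCP => x /=; exact: mulrCA. Qed.
HB.instance Definition _ := GRing.Lalgebra_isAlgebra.Build R[i] (contC R G)
  contC_scaleAr.

Lemma contC_conjD : {morph contC_conj : f g / f + g}.
Proof. by move=> f g; apply: contCP => x /=; exact: rmorphD. Qed.
Lemma contC_conjZ (c : R[i]) f : contC_conj (c *: f) = c^* *: contC_conj f.
Proof. by apply: contCP => x /=; exact: rmorphM. Qed.
Lemma contC_conjM f g : contC_conj (f * g) = contC_conj g * contC_conj f.
Proof. by apply: contCP => x /=; rewrite [RHS]mulrC; exact: rmorphM. Qed.
Lemma contC_conjK : involutive contC_conj.
Proof. by move=> f; apply: contCP => x /=; exact: conjCK. Qed.

HB.instance Definition _ := isStarAlgebra.Build R (contC R G)
  contC_conjD contC_conjZ contC_conjM contC_conjK.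
End ContC.

(* Z/2 is bool with addition addb, its topology being discrete. *)
Definition Z2prod : Type := prod_topology (fun _ : nat => bool).

HB.instance Definition _ := Topological.copy Z2prod
  (prod_topology (fun _ : nat => bool)).

Section Z2Prod.
Implicit Types g h : Z2prod.

Definition Z2prod_one : Z2prod := fun=> false.
Definition Z2prod_mul g h : Z2prod := fun n => g n (+) h n.
Definition Z2prod_inv g : Z2prod := g.

Lemma Z2prod_mulA : associative Z2prod_mul.
Proof. by move=> f g h; apply/funext => n; exact: addbA. Qed.
Lemma Z2prod_mul1 : left_id Z2prod_one Z2prod_mul.
Proof. by move=> f; apply/funext => n; exact: addFb. Qed.
Lemma Z2prod_mulr1 : right_id Z2prod_one Z2prod_mul.
Proof. by move=> f; apply/funext => n; exact: addbF. Qed.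
Lemma Z2prod_mulV : left_inverse Z2prod_one Z2prod_inv Z2prod_mul.
Proof. by move=> f; apply/funext => n; exact: addbb. Qed.
Lemma Z2prod_mulrV : right_inverse Z2prod_one Z2prod_inv Z2prod_mul.
Proof. by move=> f; apply/funext => n; exact: addbb. Qed.

HB.instance Definition _ := isGroup.Build Z2prod
  Z2prod_mulA Z2prod_mul1 Z2prod_mulr1 Z2prod_mulV Z2prod_mulrV.

Lemma Z2prod_mul_continuous :
  continuous (fun gh : Z2prod * Z2prod => (gh.1 * gh.2)%g).
Proof.
have near_coord n g : \forall h \near g, h n = g n.
  have := @proj_continuous _ (fun _ : nat => bool) n g.
  by move=> /discrete_cvg; apply.
move=> [g h]; apply/cvg_sup => n U /= [_ [[V oV <-] /= Vgh] VU].
have gn : \forall gh \near (g, h), gh.1 n = g n.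
  exact: (@cvg_fst _ _ (nbhs g) (nbhs h) _ _ (near_coord n g)).
have hn : \forall gh \near (g, h), gh.2 n = h n.
  exact: (@cvg_snd _ _ (nbhs g) (nbhs h) _ _ (near_coord n h)).
rewrite /nbhs/=; near=> gh; apply: VU => /=.
suff -> : (gh.1 * gh.2)%g n = (g * h)%g n by [].
change (gh.1 n (+) gh.2 n = g n (+) h n); congr (_ (+) _); near: gh.
Unshelve. all: by end_near. Qed.

Lemma Z2prod_inv_continuous : continuous (fun g : Z2prod => g^-1%g).
Proof. by move=> g; exact: cvg_id. Qed.

HB.instance Definition _ := isTopologicalGroup.Build Z2prod
  Z2prod_mul_continuous Z2prod_inv_continuous.
End Z2Prod.

Section StarMaps.
Variables (R : realType) (C D : starAlgType R).

Definition star_hom (f : C -> D) : Prop :=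
  [/\ linear f, {morph f : x y / x * y}, f 1 = 1 & {morph f : x / star x}].

End StarMaps.

Definition star_automorphism (R : realType) (A : starAlgType R) (f : A -> A) :=
  star_hom f /\ bijective f.

(* A subalgebra is given by its carrier S; positive elements are those of the *)
(* form b^* b, with b in the same subalgebra.                                 *)
Section Positivity.
Variables (R : realType) (A : starAlgType R).
Implicit Types (S : set A) (a b p : A).

Definition positive_in S a : Prop := exists2 b, S b & a = star b * b.

Definition le_star a b : Prop := positive_in setT (b - a).

Definition mx_star n (X : 'M[A]_n) : 'M[A]_n := (map_mx star X)^T.

Definition mx_positive_in S n (X : 'M[A]_n) : Prop :=
  exists2 Y : 'M[A]_n, (forall i j, S (Y i j)) & X = mx_star Y *m Y.

Definition projection p : Prop := star p = p /\ p * p = p.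

Definition partial_isometry (s : A) : Prop := s * star s * s = s.

Definition corner p : set A := [set a | p * a * p = a].

End Positivity.

(* Unital completely positive maps D -> pAp, the unit of pAp being p.         *)
Definition ucp_corner (R : realType) (D A : starAlgType R) (p : A)
    (phi : D -> A) : Prop :=
  [/\ linear phi,
      forall f, corner p (phi f),
      phi 1 = p &
      forall n (X : 'M[D]_n),
        mx_positive_in setT X -> mx_positive_in (corner p) (map_mx phi X)].

Definition cuntz_sub (R : realType) (A : cstarType R) (S : set A) (a b : A) :
    Prop :=
  exists2 v : nat -> A, (forall n, S (v n)) &
    cnorm (v n * b * star (v n) - a) @[n --> \oo] --> (0 : R).

Section Actions.
Variables (R : realType) (G : topologicalGroupType) (A : cstarType R).
Implicit Types (alpha : G -> A -> A) (F : set A) (S : set (contC R G)).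
Implicit Types (eps : R) (x y p s : A) (phi : contC R G -> A).

Record continuous_action alpha : Prop := {
  action_aut : forall g, star_automorphism (alpha g);
  action_one : forall a, alpha 1%g a = a;
  action_mul : forall g h a, alpha (g * h)%g a = alpha g (alpha h a);
  action_cont : forall a g eps, 0 < eps ->
    \forall h \near g, cnorm (alpha h a - alpha g a) < eps
}.

Definition fixed alpha : set A := [set a | forall g, alpha g a = a].

Record approx_equivariant_central_mult alpha F S eps phi : Prop := {
  aecm_mult : forall f1 f2, S f1 -> S f2 ->
    cnorm (phi (f1 * f2) - phi f1 * phi f2) < eps;
  aecm_central : forall f a, S f -> F a ->
    cnorm (phi f * a - a * phi f) < eps;
  aecm_equivariant : forall f, S f ->
    (ereal_sup [set (cnorm (phi (Lt g f) - alpha g (phi f)))%:E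
               | g in [set: G]] < eps%:E)%E
}.

Record trp_comparison_conditions alpha F S eps x y p phi : Prop := {
  trpc_proj : projection p /\ fixed alpha p;
  trpc_ucp : ucp_corner p phi;
  trpc_aecm : approx_equivariant_central_mult alpha F S eps phi;
  trpc_x : cuntz_sub setT (1 - p) x;
  trpc_y : cuntz_sub (fixed alpha) (1 - p) y;
  trpc_p : cuntz_sub (fixed alpha) (1 - p) p;
  trpc_norm : 1 - eps < cnorm (p * x * p)
}.

Record strong_modified_trp_conditions alpha F S eps x p phi s : Prop := {
  smtrp_piso : partial_isometry s /\ fixed alpha s;
  smtrp_proj : projection p /\ fixed alpha p;
  smtrp_ucp : ucp_corner p phi;
  smtrp_aecm : approx_equivariant_central_mult alpha F S eps phi;
  smtrp_x : cuntz_sub setT (1 - p) x;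
  smtrp_s : star s * s = 1 - p /\ le_star (s * star s) p;
  smtrp_central : forall a, F a -> cnorm (s * a - a * s) < eps;
  smtrp_norm : 1 - eps < cnorm (p * x * p)
}.

Definition tracial_Rokhlin_with_comparison alpha : Prop :=
  forall F S eps x y, finite_set F -> finite_set S -> 0 < eps ->
    positive_in setT x -> cnorm x = 1 ->
    positive_in (fixed alpha) y -> y <> 0 ->
  exists p phi, trp_comparison_conditions alpha F S eps x y p phi.

Definition strong_modified_tracial_Rokhlin alpha : Prop :=
  forall F S eps x, finite_set F -> finite_set S -> 0 < eps ->
    positive_in setT x -> cnorm x = 1 ->
  exists s p phi, strong_modified_trp_conditions alpha F S eps x p phi s.

End Actions.

Section InfiniteTensorProduct.
Variable R : realType.

Definition lin_indep (V : lmodType R[i]) (I : finType) (v : I -> V) : Prop :=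
  forall c : I -> R[i], \sum_i c i *: v i = 0 -> forall i, c i = 0.

Variables (D : nat -> starAlgType R) (A : cstarType R).

Definition elementary_tensor (j : forall k, D k -> A) n (x : forall k, D k) : A :=
  \prod_(k < n) j k (x k).

(* (A, j) is a C*-algebra completion of the algebraic infinite tensor product *)
(* of the D k: the unital *-homomorphisms j k have commuting ranges, the map  *)
(* they induce on the algebraic tensor product of D 0, ..., D n.-1 is         *)
(* injective (tensors of linearly independent families stay linearly          *)
(* independent) and the images are jointly dense. When all D k are nuclear    *)
(* C*-algebras, the algebraic tensor product has only one C*-norm, so (A, j)  *)
(* is the infinite tensor product, up to a unique isomorphism.                *)
Record infinite_tensor_product (j : forall k, D k -> A) : Prop := {
  itp_hom : forall k, star_hom (j k);
  itp_comm : forall k l x y, k != l -> j k x * j l y = j l y * j k x;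
  itp_inj : forall n (m : nat -> nat) (e : forall k, 'I_(m k) -> D k),
    (forall k, (k < n)%N -> lin_indep (@e k)) ->
    lin_indep (fun i : {dffun forall k : 'I_n, 'I_(m k)} =>
      \prod_(k < n) j k (e k (i k)));
  itp_dense : forall a (eps : R), 0 < eps ->
    exists n (xs : seq (forall k, D k)),
      cnorm (a - \sum_(x <- xs) elementary_tensor j n x) < eps
}.

Definition is_tensor_map (j : forall k, D k -> A) (f : forall k, D k -> D k)
    (F : A -> A) : Prop :=
  forall n x, F (elementary_tensor j n x) =
              elementary_tensor j n (fun k => f k (x k)).

End InfiniteTensorProduct.

Definition r (k : nat) : nat := (3 ^ k - 1)./2.

Lemma r_dim k : (r k + r k + 1 = (3 ^ k).-1.+1)%N.
Proof.
have odd3 : odd (3 ^ k) by rewrite oddX orbT.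
have pos3 : (0 < 3 ^ k)%N by rewrite expn_gt0.
rewrite /r subn1 addn1 addnn halfK; congr _.+1.
by rewrite -subn1 oddB // odd3 subn0.
Qed.

(* The size 3 ^ k is written as a successor, as the library requires for the  *)
(* algebra structure on square matrices.                                      *)
Definition M3 (R : realType) (k : nat) : starAlgType R :=
  'M[R[i]]_((3 ^ k).-1.+1).

Definition w (R : realType) (k : nat) : M3 R k :=
  castmx (r_dim k, r_dim k)
    (block_mx (block_mx 0 1%:M 1%:M 0 : 'M[R[i]]_(r k + r k)) 0 0 1%:M).

Definition Ad (R : realType) (C : starAlgType R) (u x : C) : C :=
  u * x * star u.

(* The action of Z/2 (as bool) generated by an order two map.                 *)
Definition Z2_action (X : Type) (nu : X -> X) (b : bool) (x : X) : X :=
  if b then nu x else x.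

(* Main.v *)
Require Import Defs.
From mathcomp Require Import all_boot all_order all_algebra.
From mathcomp Require Import complex.
From mathcomp Require Import all_classical all_reals all_analysis.
From mathcomp Require Import ring lra zify.
Import Order.TTheory GRing.Theory Num.Theory numFieldNormedType.Exports.
Local Open Scope classical_set_scope.
Local Open Scope ring_scope.
Local Open Scope complex_scope.

(** In the matrix factor M_(3^k) of the n-th copy of B, the coordinate g_n of the
    group exchanges the projections e_0 and e_1 onto the two blocks of size r(k)
    and fixes the remaining rank one projection. For n < N and one large k these
    projections generate a copy of C((Z/2)^N) with the translation action, whose
    unit p is the product of the e_0 + e_1. Sending f to the combination of the
    minimal projections with coefficients the values of f at sequences that
    vanish beyond N gives phi, an honest star-homomorphism into p A p. It is
    equivariant up to the oscillation of f on sets of sequences with common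
    first N coordinates, and it commutes with every element of the finite tensor
    products that do not involve the factor k; such elements are dense.

    The rest is a comparison of 1 - p with p, x and y. The element y = b^* b is
    approximated by c^* c with c in a finite tensor product, which is a matrix
    algebra with a basis of eigenvectors for the characters of (Z/2)^N;
    averaging c over the group makes it block diagonal. A top eigenvector of
    c^* c inside one block (top_line) gives a rank one projection q, fixed by the
    action, such that q y q is nearly a positive multiple of q. A Newton
    iteration (cuntz_newton) then shows that q is Cuntz subequivalent to y in the
    fixed point algebra. For x the same is done in A, without characters.

    It remains to find v with v v^* = 1 - p and v q = v, and this is a matter of
    counting (absorb). In the tensor product of the matrix algebra with the
    factors carrying p, the eigenvectors in the range of 1 - p are far fewer than
    the eigenvectors under q p of any given character, as 1 - p has dimension of
    order 3^(k (N-1)) and each character has multiplicity r(k)^N. An injection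
    matching the characters defines a fixed v. Taking the trivial matrix algebra
    instead, one obtains an element which commutes with the finite tensor
    products, and s is its adjoint.

    For the norm condition, p q is a nonzero projection, so the norm of p x p is
    at least about the eigenvalue, which is about the norm of x.

    The norm estimates need two facts about C*-algebras: star-homomorphisms are
    contractive (star_hom_contractive), and a diagonal element is bounded by its
    coefficients (cnorm_diag_le). Both follow from the identity for the norm of
    powers of self-adjoint elements. *)

Set Implicit Arguments.
Unset Strict Implicit.
Unset Printing Implicit Defensive.

Local Notation conj c := (Num.conj c : _[i]).

Lemma conj_real (R : realType) (t : R) : conj t%:C = t%:C.
Proof. exact: conjc_real. Qed.

(** * Stars, star-homomorphisms and the norm *)

Section StarAlgebraBasics.
Variables (R : realType) (A : starAlgType R).
Implicit Types (a b x y : A).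

Lemma star0 : star (0 : A) = 0.
Proof. by apply: (addrI (star 0)); rewrite -starD !addr0. Qed.

Lemma starN : {morph (@star R A) : x / - x}.
Proof. by move=> x; apply: (addrI (star x)); rewrite -starD !subrr star0. Qed.

Lemma starB : {morph (@star R A) : x y / x - y}.
Proof. by move=> x y; rewrite starD starN. Qed.

Lemma star1 : star (1 : A) = 1.
Proof. by rewrite -[LHS]mul1r -{1}[1]starK -starM mul1r starK. Qed.

Lemma star_sum (I : Type) (s : seq I) (P : pred I) (f : I -> A) :
  star (\sum_(i <- s | P i) f i) = \sum_(i <- s | P i) star (f i).
Proof. exact: (big_morph _ starD star0). Qed.

Lemma starZc (c : R[i]) x : star (c *: x) = conj c *: star x.
Proof. exact: starZ. Qed.

Lemma starZr (t : R) x : star (t%:C *: x) = t%:C *: star x.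
Proof. by rewrite starZc conj_real. Qed.

End StarAlgebraBasics.

Section StarHomBasics.
Variables (R : realType) (C D : starAlgType R) (f : C -> D).
Hypothesis hf : star_hom f.

Lemma star_homD : {morph f : x y / x + y}.
Proof. by case: hf => lf _ _ _ x y; have := lf 1 x y; rewrite !scale1r. Qed.

Lemma star_hom0 : f 0 = 0.
Proof. by apply: (addrI (f 0)); rewrite -star_homD !addr0. Qed.

Lemma star_homZ c x : f (c *: x) = c *: f x.
Proof.
by case: hf => lf _ _ _; have := lf c x 0; rewrite star_hom0 !addr0.
Qed.

Lemma star_homN : {morph f : x / - x}.
Proof. by move=> x; rewrite -scaleN1r star_homZ scaleN1r. Qed.

Lemma star_homB : {morph f : x y / x - y}.
Proof. by move=> x y; rewrite star_homD star_homN. Qed.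

Lemma star_homM : {morph f : x y / x * y}.
Proof. by case: hf. Qed.

Lemma star_hom1 : f 1 = 1.
Proof. by case: hf. Qed.

Lemma star_hom_star : {morph f : x / star x}.
Proof. by case: hf. Qed.

Lemma star_hom_sum (I : Type) (s : seq I) (P : pred I) (g : I -> C) :
  f (\sum_(i <- s | P i) g i) = \sum_(i <- s | P i) f (g i).
Proof. exact: (big_morph _ star_homD star_hom0). Qed.

Lemma star_hom_prod (I : Type) (s : seq I) (P : pred I) (g : I -> C) :
  f (\prod_(i <- s | P i) g i) = \prod_(i <- s | P i) f (g i).
Proof. exact: (big_morph _ star_homM star_hom1). Qed.

End StarHomBasics.

Section CStarNorm.
Variables (R : realType) (A : cstarType R).
Implicit Types (a b p x y z : A).

Lemma cnormZr (t : R) x : cnorm (t%:C *: x) = `|t| * cnorm x.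
Proof. by rewrite cnormZ normc_def /= expr0n /= addr0 sqrtr_sqr. Qed.

Lemma cnorm0 : cnorm (0 : A) = 0.
Proof. by have := cnormZr 0 0; rewrite scaler0 normr0 mul0r. Qed.

Lemma cnormN x : cnorm (- x) = cnorm x.
Proof.
have := cnormZr (-1) x; rewrite normrN1 mul1r => <-.
by rewrite rmorphN rmorph1 scaleN1r.
Qed.

Lemma cnorm_ge0 x : 0 <= cnorm x.
Proof.
have := cnorm_triangle x (- x); rewrite subrr cnorm0 cnormN.
by rewrite -mulr2n -mulr_natr pmulr_lge0.
Qed.

Lemma cnormB x y : cnorm (x - y) <= cnorm x + cnorm y.
Proof. by have := cnorm_triangle x (- y); rewrite cnormN. Qed.

Lemma cnormC x y : cnorm (x - y) = cnorm (y - x).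
Proof. by rewrite -cnormN opprB. Qed.

Lemma cnorm_tri3 x y z : cnorm (x - z) <= cnorm (x - y) + cnorm (y - z).
Proof. by rewrite -[x - z](subrKA y) cnorm_triangle. Qed.

Lemma cnorm_le_dist x y : cnorm x <= cnorm y + cnorm (x - y).
Proof. by have := cnorm_triangle y (x - y); rewrite addrC subrK. Qed.

Lemma cnorm_sum (I : Type) (s : seq I) (P : pred I) (f : I -> A) :
  cnorm (\sum_(i <- s | P i) f i) <= \sum_(i <- s | P i) cnorm (f i).
Proof.
elim/big_ind2: _ => [|a b c d ab cd|//]; first by rewrite cnorm0.
by rewrite (le_trans (cnorm_triangle _ _)) // lerD.
Qed.

Lemma cnormM_le x y (s t : R) : cnorm x <= s -> cnorm y <= t ->
  cnorm (x * y) <= s * t.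
Proof.
move=> xs yt; apply: le_trans (cnormM _ _) _.
by apply: ler_pM xs yt; apply: cnorm_ge0.
Qed.

Lemma cnormM3_le x y z : cnorm (x * y * z) <= cnorm x * cnorm y * cnorm z.
Proof. by apply: cnormM_le => //; apply: cnormM. Qed.

Lemma cnormV x : cnorm (star x) = cnorm x.
Proof.
have le y : cnorm y <= cnorm (star y).
  have := cnorm_star y; have := cnormM (star y) y => H E.
  have [->|y0] := eqVneq (cnorm y) 0; first exact: cnorm_ge0.
  have yp : 0 < cnorm y by rewrite lt_def y0 cnorm_ge0.
  by rewrite -(ler_pM2r yp) -expr2 -E.
by apply/eqP; rewrite eq_le le -{2}[x]starK le.
Qed.

Lemma cnorm1 : cnorm (1 : A) = 1.
Proof.
have := cnorm_star (1 : A); rewrite star1 mul1r => /eqP.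
have /negPf n1 : cnorm (1 : A) != 0.
  by apply/eqP => /cnorm_eq0/eqP; rewrite oner_eq0.
by rewrite -subr_eq0 expr2 -{1}[cnorm 1]mul1r -mulrBl mulf_eq0 n1 orbF subr_eq0 eq_sym => /eqP.
Qed.

Lemma cnorm_gt0 x : x <> 0 -> 0 < cnorm x.
Proof.
move=> x0; rewrite lt_def cnorm_ge0 andbT; apply/eqP => /cnorm_eq0; exact: x0.
Qed.

Lemma cnorm_proj_le1 p : projection p -> cnorm p <= 1.
Proof.
move=> [ps pp]; have := cnorm_star p; rewrite ps pp.
have [-> //|p0] := eqVneq (cnorm p) 0.
by move/eqP; rewrite -{1}[cnorm p]mulr1 expr2 -subr_eq0 -mulrBr mulf_eq0 (negPf p0) subr_eq0 => /eqP <-.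
Qed.

Lemma cnorm_proj p : projection p -> p <> 0 -> cnorm p = 1.
Proof.
move=> [ps pp] p0; have := cnorm_star p; rewrite ps pp.
have pn := lt0r_neq0 (cnorm_gt0 p0).
by move/eqP; rewrite -{1}[cnorm p]mulr1 expr2 -subr_eq0 -mulrBr mulf_eq0 (negPf pn) subr_eq0 => /eqP <-.
Qed.

End CStarNorm.

Section PowerTrick.
Variable R : realType.

(** In a C*-algebra the norm of a normal element is multiplicative on powers of
    exponent 2^m, so a crude estimate valid for all of them loses its constant
    through this lemma. It replaces the spectral radius formula. *)
Lemma bounded_pow_le1 (t K : R) : 0 <= t -> (forall m, t ^+ (2 ^ m) <= K) ->
  t <= 1.
Proof.
move=> t0 H; rewrite leNgt; apply/negP => t1.
have bern n : 1 + n%:R * (t - 1) <= t ^+ n.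
  elim: n => [|n IH]; first by rewrite mul0r addr0 expr0.
  rewrite exprS; apply: le_trans (ler_wpM2l t0 IH).
  have : 0 <= n%:R * (t - 1) ^+ 2 by rewrite mulr_ge0 // ?sqr_ge0.
  by rewrite -[n.+1%:R]natr1; nra.
pose M := Num.bound (`|K| / (t - 1)).
have M1 : `|K| / (t - 1) < M%:R.
  by rewrite /M; have := archi_boundP (x := `|K| / (t-1)); apply; rewrite divr_ge0 // subr_ge0 ltW.
move: M1; rewrite ltr_pdivrMr ?subr_gt0 // => M1.
have := H M; apply/negP; rewrite -ltNge.
have : M%:R <= (2 ^ M)%:R :> R by rewrite ler_nat ltnW // ltn_expl.
have := bern (2 ^ M)%N; have := ler_norm K.
have : 0 < t - 1 by rewrite subr_gt0.
nra.
Qed.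

End PowerTrick.

(** * Norms of diagonal elements, square roots and contractivity *)

Section DiagonalNorm.
Variables (R : realType) (A : cstarType R) (X : finType) (P : X -> A).
Hypothesis PP : forall i j, P i * P j = if i == j then P i else 0.
Hypothesis Ps : forall i, star (P i) = P i.

Lemma diag_mul (a b : X -> R[i]) :
  (\sum_i a i *: P i) * (\sum_i b i *: P i) = \sum_i (a i * b i) *: P i.
Proof.
rewrite mulr_suml; apply: eq_bigr => i _; rewrite mulr_sumr (bigD1 i) //=.
rewrite big1 ?addr0 => [|k /negPf ki]; last first.
  by rewrite -scalerAl -scalerAr PP eq_sym ki !scaler0.
by rewrite -scalerAl -scalerAr PP eqxx scalerA.
Qed.

Lemma diag_star (a : X -> R[i]) :
  star (\sum_i a i *: P i) = \sum_i conj (a i) *: P i.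
Proof. by rewrite star_sum; apply: eq_bigr => i _; rewrite starZc Ps. Qed.

(** The triangle inequality gives the bound up to the constant equal to the sum
    of the norms of the P i; squaring the coefficients squares the norm, and
    the power trick removes the constant. *)
Lemma cnorm_diag_le (d : X -> R[i]) (M : R) : 0 <= M ->
  (forall i, `|d i| <= M%:C) -> cnorm (\sum_i d i *: P i) <= M.
Proof.
have unit_case (a : X -> R[i]) : (forall i, `|a i| <= 1) ->
    cnorm (\sum_i a i *: P i) <= 1.
  move=> a1; apply: (@bounded_pow_le1 _ _ (\sum_i cnorm (P i))).
    exact: cnorm_ge0.
  move=> m; elim: m a a1 => [|m IH] a a1.
    rewrite expn0 expr1; apply: le_trans (cnorm_sum _ _ _) _.
    apply: ler_sum => i _; rewrite cnormZ; apply: ler_piMl (cnorm_ge0 _) _.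
    by have := a1 i; rewrite lecE /= => /andP[].
  rewrite expnS exprM -cnorm_star diag_star diag_mul; apply: IH => i.
  by rewrite normrM norm_conjC mulr_ile1.
rewrite le_eqVlt => /orP[/eqP<- d0|M0 dM].
  rewrite big1 ?cnorm0 // => i _; have := d0 i; rewrite normr_le0 => /eqP->.
  by rewrite scale0r.
have MC : 0 < M%:C :> R[i] by rewrite ltcR.
have := unit_case (fun i => M%:C^-1 * d i).
have -> : \sum_i (M%:C^-1 * d i) *: P i = (M^-1)%:C *: \sum_i d i *: P i.
  rewrite scaler_sumr; apply: eq_bigr => i _.
  by rewrite scalerA rmorphV ?unitfE ?gt_eqF.
rewrite cnormZr gtr0_norm ?invr_gt0 // mulrC ler_pdivrMr // mul1r; apply => i.
rewrite normrM normfV (gtr0_norm MC) mulrC ler_pdivrMr // mul1r; exact: dM.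
Qed.
End DiagonalNorm.

Section Limits.
Variables (R : realType) (A : cstarType R).

Lemma cnorm_cvg0P (u : nat -> R) : (forall n, 0 <= u n) ->
  (u n @[n --> \oo] --> (0 : R)) <->
  (forall e, 0 < e -> exists N, forall n, (N <= n)%N -> u n < e).
Proof.
move=> u0; split=> [cu e e0|H].
  have /cvgrPdist_lt/(_ e e0)[N _ HN] := cu.
  by exists N => n Nn; have := HN n Nn; rewrite /= sub0r normrN ger0_norm.
apply/cvgrPdist_lt => e e0; have [N HN] := H e e0.
by exists N => // n /= Nn; rewrite sub0r normrN ger0_norm // HN.
Qed.

Lemma cnorm_small_eq (x y : A) (K : R) :
  (forall e, 0 < e -> e < 1 -> cnorm (x - y) <= K * e) -> x = y.
Proof.
move=> H; apply/eqP; rewrite -subr_eq0; apply/eqP; apply: contrapT => xy.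
have c0 := cnorm_gt0 xy; set c := cnorm (x - y) in c0.
have K0 : 0 < `|K| + c + 1 by have := normr_ge0 K; lra.
have e0 : 0 < c / (2 * (`|K| + c + 1)) by rewrite divr_gt0 // mulr_gt0.
have e1 : c / (2 * (`|K| + c + 1)) < 1.
  rewrite ltr_pdivrMr ?mulr_gt0 // mul1r; have := normr_ge0 K; lra.
have := H _ e0 e1; rewrite -/c mulrA ler_pdivlMr ?mulr_gt0 //.
have := ler_norm K; have := normr_ge0 K; nra.
Qed.

End Limits.

Section SquareRoot.
Variables (R : realType) (A : cstarType R) (h : A).
Hypotheses (hs : star h = h) (h2 : cnorm h <= 2^-1).

Let t n : A := iter n (fun t => (2^-1)%:C *: (h * h + t * t)) 0.

Let cnorm_half (x : A) : cnorm ((2^-1)%:C *: x) = 2^-1 * cnorm x.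
Proof. by rewrite cnormZr ger0_norm. Qed.

Let t_le n : cnorm (t n) <= 2^-1.
Proof.
elim: n => [|n IH]; first by rewrite cnorm0; lra.
rewrite /t iterS -/(t n) cnorm_half.
have := cnorm_triangle (h * h) (t n * t n).
have := cnormM_le h2 h2; have := cnormM_le IH IH; lra.
Qed.

Let t_star n : star (t n) = t n.
Proof.
elim: n => [|n IH]; first exact: star0.
by rewrite /t iterS -/(t n) starZr starD !starM hs IH.
Qed.

Let t_comm n : h * t n = t n * h.
Proof.
elim: n => [|n IH]; first by rewrite mulr0 mul0r.
rewrite /t iterS -/(t n) -scalerAl -scalerAr mulrDl mulrDr; congr (_ *: (_ + _)).
  by rewrite mulrA.
by rewrite mulrA IH -mulrA IH mulrA.
Qed.

Let sqr_dist (x y : A) : cnorm (x * x - y * y) <= cnorm (x - y) * (cnorm x + cnorm y).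
Proof.
have -> : x * x - y * y = x * (x - y) + (x - y) * y.
  by rewrite mulrBr mulrBl addrA subrK.
have := cnorm_triangle (x * (x - y)) ((x - y) * y).
have := cnormM x (x - y); have := cnormM (x - y) y; lra.
Qed.

Let t_cauchy n k : cnorm (t (n + k) - t n) <= 2^-1 ^+ n.
Proof.
elim: n => [|n IH]; first by rewrite subr0 add0n; have := t_le k; rewrite expr0; lra.
rewrite addSn /t !iterS -/(t _) -/(t n) -scalerBr [X in X - _]addrC addrKA.
rewrite cnorm_half exprS ler_pM2l //; apply: le_trans (sqr_dist _ _) _.
have := t_le n; have := t_le (n + k); have := cnorm_ge0 (t (n + k) - t n).
nra.
Qed.

(** If t = (h^2 + t^2)/2 then (1 - t)^2 = 1 - h^2. The right-hand side is a
    contraction of the ball of radius 1/2, and its iterates from 0 are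
    self-adjoint and commute with h, so the fixed point does as well. *)
Lemma sqrt_one_sub_sqr :
  exists k : A, [/\ star k = k, h * k = k * h & k * k = 1 - h * h].
Proof.
have geo e : 0 < e -> exists N, forall n, (N <= n)%N -> (2^-1 : R) ^+ n < e.
  have u0 n : 0 <= (2^-1 : R) ^+ n by rewrite exprn_ge0.
  apply: (proj1 (cnorm_cvg0P u0)).
  by apply: cvg_expr; rewrite ger0_norm; lra.
have [e e0|l lt0] := @cnorm_complete R A t.
  have [N HN] := geo (e / 2) ltac:(by rewrite divr_gt0).
  exists N => m n Nm Nn; have := HN N (leqnn _).
  have := t_cauchy N (m - N); have := t_cauchy N (n - N); rewrite !subnKC //.
  have := cnorm_tri3 (t m) (t N) (t n); rewrite (cnormC (t N) (t n)); lra.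
have lt : forall e, 0 < e -> exists n, cnorm (t n - l) < e /\ cnorm (t n.+1 - l) < e.
  move=> e e0; have [N HN] := proj1 (cnorm_cvg0P (fun n => cnorm_ge0 (t n - l))) lt0 e e0; exists N.
  by split; apply: HN.
have ls : star l = l.
  apply: (@cnorm_small_eq _ _ _ _ 2) => e e0 e1; have [n [te _]] := lt e e0.
  have := cnorm_tri3 (star l) (t n) l; rewrite -{1}t_star -starB cnormV (cnormC l).
  lra.
have lc : h * l = l * h.
  apply: (@cnorm_small_eq _ _ _ _ 1) => e e0 e1; have [n [te _]] := lt e e0.
  have := cnorm_tri3 (h * l) (h * t n) (l * h); rewrite {2}t_comm -mulrBr -mulrBl.
  have := cnormM h (l - t n); have := cnormM (t n - l) h.
  rewrite (cnormC l (t n)) [cnorm (t n - l) * _]mulrC.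
  have := ler_wpM2r (cnorm_ge0 (t n - l)) h2; lra.
have lE : l = (2^-1)%:C *: (h * h + l * l).
  apply: (@cnorm_small_eq _ _ _ _ 3) => e e0 e1; have [n [te te1]] := lt e e0.
  have := cnorm_tri3 l (t n.+1) ((2^-1)%:C *: (h * h + l * l)).
  rewrite {2}/t iterS -/(t n) -scalerBr [X in X - (_ + _)]addrC addrKA.
  rewrite cnorm_half (cnormC l (t n.+1)).
  have := cnorm_le_dist l (t n); rewrite (cnormC l (t n)) => ll.
  have s2 : cnorm (t n) + cnorm l <= 2 by have := t_le n; lra.
  have := ler_wpM2l (cnorm_ge0 (t n - l)) s2; have := sqr_dist (t n) l; lra.
exists (1 - l); split; first by rewrite starB star1 ls.
  by rewrite mulrBr mulrBl mul1r mulr1 lc.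
have : l + l = h * h + l * l.
  rewrite {1 2}lE -scalerDl -rmorphD /= (_ : 2^-1 + 2^-1 = 1) ?scale1r //; lra.
rewrite mulrBr mulr1 mulrBl mul1r => e.
have -> : h * h = l + l - l * l by rewrite e addrK.
by rewrite -addrA -opprD addrA.
Qed.
End SquareRoot.

Section Contractive.
Variables (R : realType) (C D : cstarType R) (f : C -> D).
Hypothesis hf : star_hom f.

(** A self-adjoint h with norm at most 1/2 is the real part of a unitary
    h + i k, with k a square root of 1 - h^2; unitaries go to unitaries. *)
Let small_case (h : C) : star h = h -> cnorm h <= 2^-1 -> cnorm (f h) <= 1.
Proof.
move=> hs h2; have [k [ks hk kk]] := sqrt_one_sub_sqr hs h2.
have conji : conj ('i : R[i]) = - 'i by rewrite conjCi.
have ii : 'i * 'i = - 1 :> R[i] by rewrite -expr2 sqrCi.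
pose u := h + 'i *: k.
have us : star u = h - 'i *: k by rewrite starD starZc hs ks conji scaleNr.
have uu : star u * u = 1.
  rewrite us mulrDr !mulrBl -!scalerAl -!scalerAr scalerA ii scaleN1r.
  by rewrite hk opprK kk addrA subrK addrC subrK.
have fu : cnorm (f u) = 1.
  have := cnorm_star (f u); rewrite -(star_hom_star hf) -(star_homM hf) uu.
  rewrite (star_hom1 hf) cnorm1 => /esym/eqP; rewrite sqrf_eq1 => /orP[/eqP//|].
  by move/eqP=> E; have := cnorm_ge0 (f u); rewrite E; lra.
have -> : h = (2^-1)%:C *: (u + star u).
  rewrite us /u addrACA subrr addr0 scalerDr -scalerDl -rmorphD /=.
  by rewrite (_ : 2^-1 + 2^-1 = 1) ?scale1r //; lra.
rewrite (star_homZ hf) cnormZr (star_homD hf) (star_hom_star hf) ger0_norm //.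
have := cnorm_triangle (f u) (star (f u)); rewrite cnormV fu; lra.
Qed.

Let selfadj_case (h : C) : star h = h -> cnorm (f h) <= 2 * cnorm h.
Proof.
move=> hs; have [h0|/eqP h0] := eqVneq h 0.
  by rewrite h0 (star_hom0 hf) !cnorm0 mulr0.
have c0 := cnorm_gt0 h0; set c := cnorm h in c0 *.
have k0 : 0 <= (2 * c)^-1 by rewrite invr_ge0; lra.
have := @small_case ((2 * c)^-1%:C *: h).
rewrite starZr hs (star_homZ hf) !cnormZr ger0_norm //.
rewrite -/c invfM -mulrA mulVf ?gt_eqF // mulr1 => /(_ erefl (lexx _)).
by rewrite mulrC -invfM ler_pdivrMr ?mulr_gt0 // mul1r.
Qed.

Lemma selfadj_pow (E : cstarType R) (h : E) m : star h = h ->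
  cnorm (h ^+ (2 ^ m)) = cnorm h ^+ (2 ^ m).
Proof.
move=> hs; have sX n : star (h ^+ n) = h ^+ n.
  elim: n => [|n IH]; first by rewrite expr0 star1.
  by rewrite {1}exprSr starM IH hs -exprS.
elim: m => [|m IH]; first by rewrite !expr1.
by rewrite expnSr !exprM expr2 -{1}sX cnorm_star IH.
Qed.

(** The bound with constant 2 on self-adjoint elements comes from unitaries; the
    power trick and the C*-identity improve it to a contraction. *)
Lemma star_hom_contractive (x : C) : cnorm (f x) <= cnorm x.
Proof.
suff sa (h : C) : star h = h -> cnorm (f h) <= cnorm h.
  rewrite -(@ler_pXn2r _ 2) ?nnegrE ?cnorm_ge0 // -!cnorm_star.
  by rewrite -(star_hom_star hf) -(star_homM hf) sa // starM starK.
move=> hs; have [h0|/eqP h0] := eqVneq h 0.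
  by rewrite h0 (star_hom0 hf) !cnorm0.
have c0 := cnorm_gt0 h0.
rewrite -[leRHS]mul1r -ler_pdivrMr //; apply: (@bounded_pow_le1 _ _ 2).
  by rewrite divr_ge0 ?cnorm_ge0.
move=> m; rewrite expr_div_n ler_pdivrMr ?exprn_gt0 // -!selfadj_pow //; last first.
  by rewrite -(star_hom_star hf) hs.
have <- : f (h ^+ (2 ^ m)) = f h ^+ (2 ^ m).
  elim: (2 ^ m)%N => [|n IH]; first by rewrite !expr0 (star_hom1 hf).
  by rewrite !exprS (star_homM hf) IH.
apply: selfadj_case.
elim: (2 ^ m)%N => [|n IH]; first by rewrite expr0 star1.
by rewrite {1}exprSr starM IH hs -exprS.
Qed.

End Contractive.

(** * Cuntz subequivalence to an approximately compressed projection *)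

Section Cuntz.
Variables (R : realType) (A : cstarType R).
Implicit Types (a b p q v x y : A).

Record star_subalgebra (S : set A) : Prop := {
  ssa_1 : S 1;
  ssa_add : forall x y, S x -> S y -> S (x + y);
  ssa_mul : forall x y, S x -> S y -> S (x * y);
  ssa_scale : forall (c : R[i]) x, S x -> S (c *: x);
  ssa_star : forall x, S x -> S (star x) }.

Lemma ssa_sub S x y : star_subalgebra S -> S x -> S y -> S (x - y).
Proof.
move=> HS Sx Sy; apply: ssa_add => //; rewrite -scaleN1r; exact: ssa_scale.
Qed.

(** With v' = (1 + e/2) v one gets v' y v'^* = (1 + e/2) (q - e) (1 + e/2),
    where the terms of first order in e cancel. *)
Lemma newton_step q v y : projection q -> star y = y -> q * v = v ->
  let e := q - v * y * star v in
  let v' := v + (2^-1)%:C *: (e * v) in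
  q * v' = v' /\ q - v' * y * star v' =
    (3 / 4)%:C *: (e * e) + (4^-1)%:C *: (e * e * e).
Proof.
move=> [qs qq] ys qv e v'.
have vq : star v * q = star v by rewrite -{2}qv starM qs.
have es : star e = e by rewrite starB qs !starM starK ys mulrA.
have qe : q * e = e by rewrite mulrBr qq !mulrA qv.
have eq : e * q = e by rewrite -{1}es -{1}qs -starM qe es.
split; first by rewrite /v' mulrDr -scalerAr mulrA qe qv.
have wE : v * y * star v = q - e by rewrite /e opprB addrC subrK.
have -> : v' * y * star v' = (1 + (2^-1)%:C *: e) * (q - e) * (1 + (2^-1)%:C *: e).
  have -> : v' = (1 + (2^-1)%:C *: e) * v by rewrite mulrDl mul1r -scalerAl.
  by rewrite starM starD star1 starZr es -wE !mulrA.
clearbody e; have two z : (2^-1)%:C *: z + (2^-1)%:C *: z = z :> A.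
  by rewrite -scalerDl -rmorphD /= (_ : 2^-1 + 2^-1 = 1) ?scale1r //; lra.
have -> : (1 + (2^-1)%:C *: e) * (q - e) = q - e + (2^-1)%:C *: (e - e * e).
  by rewrite mulrDl mul1r -scalerAl mulrBr eq.
rewrite mulrDr mulr1 -scalerAr mulrDl -scalerAl !mulrBl qe.
rewrite [_ *: (e - e * e + _)]scalerDr scalerA -rmorphM /= addrA -(addrA (q - e)) two.
rewrite addrA subrK (_ : 2^-1 * 2^-1 = 4^-1); last by lra.
have -> : (3 / 4)%:C = 1 - (4^-1)%:C :> R[i].
  by rewrite -(rmorph1 (real_complex R)) -rmorphB /=; congr (_%:C); lra.
by rewrite scalerBr scalerBl scale1r !opprD !opprK !addrA subrr add0r.
Qed.

(** Newton iteration for an inverse square root: the elements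
    v_(n+1) = (1 + e_n/2) v_n with e_n = q - v_n y v_n^* stay in S and have
    quadratically decreasing errors. *)
Lemma cuntz_newton (S : set A) q v0 y : star_subalgebra S -> projection q ->
  star y = y -> q * v0 = v0 -> S q -> S v0 -> S y ->
  cnorm (q - v0 * y * star v0) < 1 -> cuntz_sub S q y.
Proof.
move=> HS pq ys qv0 Sq Sv0 Sy; set rho := cnorm _ => r1.
have r0 : 0 <= rho by exact: cnorm_ge0.
pose e v := q - v * y * star v.
pose v n := iter n (fun v => v + (2^-1)%:C *: (e v * v)) v0.
have Se w : S w -> S (e w).
  by move=> Sw; apply: ssa_sub => //; do !apply: ssa_mul => //; apply: ssa_star.
have Sv n : S (v n).
  elim: n => [//|n IH]; rewrite /v iterS -/(v n).
  by apply: ssa_add => //; apply: ssa_scale => //; apply: ssa_mul => //; apply: Se.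
have qv n : q * v n = v n.
  elim: n => [//|n IH]; rewrite /v iterS -/(v n).
  by have [] := newton_step pq ys IH.
have le n : cnorm (e (v n)) <= rho ^+ n.+1.
  elim: n => [|n IH]; first by rewrite expr1.
  have [_ E] := newton_step pq ys (qv n).
  rewrite [e (v n.+1)]E -/(e (v n)); have e1 : rho ^+ n.+1 <= rho.
    by rewrite exprS ler_piMr // exprn_ile1 // ltW.
  set x := e (v n) in IH *; set t := cnorm x in IH *.
  have t0 : 0 <= t by exact: cnorm_ge0.
  have := cnorm_triangle ((3 / 4)%:C *: (x * x)) ((4^-1)%:C *: (x * x * x)).
  rewrite !cnormZr !ger0_norm ?divr_ge0 //.
  have := cnormM x x; have := cnormM3_le x x x; rewrite -/t.
  have : t * t * t <= t * t.
    by rewrite -[leRHS]mulr1 ler_wpM2l ?mulr_ge0 //; lra.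
  have : t * t <= rho ^+ n.+2.
    by rewrite exprS ler_pM // (le_trans IH e1).
  lra.
exists v => //; apply/(cnorm_cvg0P (fun n => cnorm_ge0 _)) => d d0.
have geo : (fun n => rho ^+ n) @ \oo --> 0 by apply: cvg_expr; rewrite ger0_norm.
have [N HN] := proj1 (cnorm_cvg0P (fun n => exprn_ge0 n r0)) geo d d0.
exists N => n Nn; rewrite cnormC; apply: le_lt_trans (le n) _; apply: HN.
exact: leqW.
Qed.

Lemma cuntz_sub_comp (S : set A) p q y u : star_subalgebra S -> S u ->
  u * q * star u = p -> cuntz_sub S q y -> cuntz_sub S p y.
Proof.
move=> HS Su uq [v Sv cv]; exists (fun n => u * v n).
  by move=> n; apply: ssa_mul.
apply/(cnorm_cvg0P (fun n => cnorm_ge0 _)) => d d0.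
have c1 : 0 < cnorm u ^+ 2 + 1 by have := sqr_ge0 (cnorm u); lra.
have [N HN] := proj1 (cnorm_cvg0P (fun n => cnorm_ge0 (v n * y * star (v n) - q)))
  cv (d / (cnorm u ^+ 2 + 1)) ltac:(by rewrite divr_gt0).
exists N => n /HN; rewrite ltr_pdivlMr // => Hn.
have -> : u * v n * y * star (u * v n) - p = u * (v n * y * star (v n) - q) * star u.
  by rewrite mulrBr mulrBl uq starM !mulrA.
apply: le_lt_trans (cnormM3_le _ _ _) _; rewrite cnormV.
have := cnorm_ge0 (v n * y * star (v n) - q); lra.
Qed.

End Cuntz.

(** * Matrix units *)

Section MatrixUnits.
Variables (R : realType) (A : starAlgType R).

Record matrix_units (X : finType) (E : X -> X -> A) : Prop := {
  mu_mul : forall i j k l, E i j * E k l = if j == k then E i l else 0;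
  mu_star : forall i j, star (E i j) = E j i;
  mu_sum : \sum_i E i i = 1 }.

Section OneSystem.
Variables (X : finType) (E : X -> X -> A).
Hypothesis HE : matrix_units E.
Implicit Types (c d u : X -> X -> R[i]).

Definition combin c : A := \sum_i \sum_j c i j *: E i j.

Lemma eq_combin c d : (forall i j, c i j = d i j) -> combin c = combin d.
Proof.
by move=> cd; apply: eq_bigr => i _; apply: eq_bigr => j _; rewrite cd.
Qed.

Lemma combinD c d : combin c + combin d = combin (fun i j => c i j + d i j).
Proof.
rewrite -big_split /=; apply: eq_bigr => i _.
by rewrite -big_split /=; apply: eq_bigr => j _; rewrite -scalerDl.
Qed.

Lemma combinZ t c : t *: combin c = combin (fun i j => t * c i j).
Proof.
rewrite scaler_sumr; apply: eq_bigr => i _; rewrite scaler_sumr.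
by apply: eq_bigr => j _; rewrite scalerA.
Qed.

Lemma combin_star c : star (combin c) = combin (fun i j => conj (c j i)).
Proof.
rewrite /combin star_sum; under eq_bigr do rewrite star_sum.
rewrite exchange_big; apply: eq_bigr => i _ /=; apply: eq_bigr => j _.
by rewrite starZc (mu_star HE).
Qed.

Lemma mulE_combin i j c : E i j * combin c = \sum_l c j l *: E i l.
Proof.
rewrite mulr_sumr [LHS](bigD1 j) //= [X in _ + X]big1 ?addr0 => [|k /negPf kj]; last first.
  by rewrite mulr_sumr big1 // => l _; rewrite -scalerAr (mu_mul HE) eq_sym kj scaler0.
by rewrite mulr_sumr; apply: eq_bigr => l _; rewrite -scalerAr (mu_mul HE) eqxx.
Qed.

Lemma combinM c d :
  combin c * combin d = combin (fun i j => \sum_k c i k * d k j).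
Proof.
rewrite mulr_suml; apply: eq_bigr => i _; rewrite mulr_suml.
under eq_bigr do rewrite -scalerAl mulE_combin scaler_sumr.
rewrite exchange_big; apply: eq_bigr => j _ /=; rewrite scaler_suml.
by apply: eq_bigr => k _; rewrite scalerA.
Qed.

Lemma combin_delta i j :
  combin (fun k l => ((k == i) && (l == j))%:R) = E i j.
Proof.
rewrite /combin (bigD1 i) //= [X in _ + X]big1 ?addr0 => [|k /negPf ki]; last first.
  by rewrite big1 // => l _; rewrite ki scale0r.
rewrite (bigD1 j) //= big1 ?addr0 => [|l /negPf lj]; last first.
  by rewrite lj andbF scale0r.
by rewrite !eqxx scale1r.
Qed.

Lemma combin1 : combin (fun k l => (k == l)%:R) = 1.
Proof.
rewrite -(mu_sum HE); apply: eq_bigr => i _.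
rewrite (bigD1 i) //= big1 ?addr0 => [|l /negPf li]; last first.
  by rewrite eq_sym li scale0r.
by rewrite eqxx scale1r.
Qed.

(** Matrix algebras are simple: one vanishing unit kills all of them, and
    with them the unit of the algebra. *)
Lemma mu_neq0 i j : E i j <> 0.
Proof.
move=> E0; have Z k : E k k = 0.
  have -> : E k k = E k i * E i j * E j k by rewrite !(mu_mul HE) !eqxx (mu_mul HE) eqxx.
  by rewrite E0 mulr0 mul0r.
have /eqP := mu_sum HE; rewrite big1 // eq_sym; exact/negP/oner_neq0.
Qed.

Lemma mu_inhabited : exists i : X, True.
Proof.
apply: contrapT => X0; have /eqP := mu_sum HE.
rewrite big1 => [|i]; last by case: X0; exists i.
by rewrite eq_sym; apply/negP/oner_neq0.
Qed.

Definition in_span a := exists c, a = combin c.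

Lemma in_span_E i j : in_span (E i j).
Proof. by exists (fun k l => ((k == i) && (l == j))%:R); rewrite combin_delta. Qed.

Lemma in_spanD a b : in_span a -> in_span b -> in_span (a + b).
Proof. by move=> [c ->] [d ->]; rewrite combinD; eexists. Qed.

Lemma in_spanM a b : in_span a -> in_span b -> in_span (a * b).
Proof. by move=> [c ->] [d ->]; rewrite combinM; eexists. Qed.

Lemma in_spanZ t a : in_span a -> in_span (t *: a).
Proof. by move=> [c ->]; rewrite combinZ; eexists. Qed.

Lemma in_span1 : in_span 1.
Proof. by rewrite -combin1; eexists. Qed.

Lemma in_span0 : in_span 0.
Proof. by rewrite -(scale0r 1); apply: in_spanZ in_span1. Qed.

Lemma in_span_sum (I : Type) (s : seq I) (P : pred I) (F : I -> A) :
  (forall i, P i -> in_span (F i)) -> in_span (\sum_(i <- s | P i) F i).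
Proof.
by move=> H; elim/big_ind: _ => //; [exact: in_span0 | exact: in_spanD].
Qed.

Definition orthonormal u := forall i j, \sum_a u i a * conj (u j a) = (i == j)%:R.

(** The matrix units of the orthonormal basis formed by the rows of u. *)
Definition rebase u i j : A := combin (fun a b => u i a * conj (u j b)).

Lemma rebase_mu u : orthonormal u ->
  (forall a b, \sum_i u i a * conj (u i b) = (a == b)%:R) ->
  matrix_units (rebase u).
Proof.
move=> ou ov; split=> [i j k l|i j|].
- rewrite combinM; have [<-|/negPf jk] := eqVneq j k.
    apply: eq_combin => a b.
    transitivity (\sum_c (u i a * conj (u l b)) * (u j c * conj (u j c))).
      by apply: eq_bigr => c _; ring.
    by rewrite -mulr_sumr ou eqxx mulr1.
  rewrite -(scale0r (combin (fun a b => u i a * conj (u l b)))) combinZ.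
  apply: eq_combin => a b; rewrite mul0r.
  transitivity (\sum_c (u i a * conj (u l b)) * (u k c * conj (u j c))).
    by apply: eq_bigr => c _; ring.
  by rewrite -mulr_sumr ou eq_sym jk mulr0.
- by rewrite combin_star; apply: eq_combin => a b; rewrite rmorphM /= conjCK mulrC.
- rewrite -combin1 /rebase /combin exchange_big; apply: eq_bigr => a _ /=.
  rewrite exchange_big; apply: eq_bigr => b _ /=.
  by rewrite -scaler_suml ov.
Qed.

Lemma rebase_span u a b :
  (forall a b, \sum_i u i a * conj (u i b) = (a == b)%:R) ->
  E a b = \sum_i \sum_j (conj (u i a) * u j b) *: rebase u i j.
Proof.
move=> ov; rewrite -combin_delta.
under eq_bigr do under eq_bigr do rewrite combinZ.
rewrite /combin.
under [RHS]eq_bigr do rewrite exchange_big.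
rewrite [RHS]exchange_big; apply: eq_bigr => k _ /=.
under [RHS]eq_bigr do rewrite exchange_big.
rewrite [RHS]exchange_big; apply: eq_bigr => l _ /=.
under eq_bigr do rewrite -scaler_suml.
rewrite -scaler_suml; congr (_ *: _).
transitivity (\sum_i (u i k * conj (u i a)) * \sum_j u j b * conj (u j l)).
  rewrite -mulr_suml !ov -natrM mulnb eq_sym; congr (_ && _)%:R.
  by rewrite eq_sym.
apply: eq_bigr => i _; rewrite mulr_sumr; apply: eq_bigr => j _; ring.
Qed.

(** In ket notation, line_proj xi is |xi><xi| and bra xi i is |i><xi|. *)
Definition line_proj (xi : X -> R[i]) : A := combin (fun i j => xi i * conj (xi j)).
Definition bra (xi : X -> R[i]) i : A := \sum_k conj (xi k) *: E i k.

Definition unit_vector (xi : X -> R[i]) := \sum_i xi i * conj (xi i) = 1.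

Lemma line_proj_projection xi : unit_vector xi -> projection (line_proj xi).
Proof.
move=> x1; split.
  by rewrite combin_star; apply: eq_combin => i j; rewrite rmorphM /= conjCK mulrC.
rewrite combinM; apply: eq_combin => i j.
transitivity (\sum_k (xi i * conj (xi j)) * (xi k * conj (xi k))).
  by apply: eq_bigr => k _; ring.
by rewrite -mulr_sumr x1 mulr1.
Qed.

Lemma line_proj_compress xi c : line_proj xi * combin c * line_proj xi =
  (\sum_i \sum_j conj (xi i) * c i j * xi j) *: line_proj xi.
Proof.
rewrite !combinM combinZ; apply: eq_combin => a b.
rewrite mulr_suml; under eq_bigr do rewrite mulr_suml.
rewrite exchange_big; apply: eq_bigr => i _ /=.
by rewrite mulr_suml; apply: eq_bigr => j _; ring.
Qed.

Lemma bra_line_proj xi i : unit_vector xi -> bra xi i * line_proj xi = bra xi i.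
Proof.
move=> x1; rewrite mulr_suml; under eq_bigr do rewrite -scalerAl mulE_combin scaler_sumr.
rewrite exchange_big; apply: eq_bigr => j _ /=.
under eq_bigr do rewrite scalerA mulrA [conj _ * _]mulrC.
by rewrite -scaler_suml -mulr_suml x1 mul1r.
Qed.

Lemma bra_mul_star xi i j : unit_vector xi -> bra xi i * star (bra xi j) = E i j.
Proof.
move=> x1; rewrite star_sum mulr_suml.
transitivity (\sum_k (xi k * conj (xi k)) *: E i j); last by rewrite -scaler_suml x1 scale1r.
apply: eq_bigr => k _; rewrite mulr_sumr (bigD1 k) //= big1 ?addr0 => [|l /negPf lk].
  rewrite starZc (mu_star HE) conjCK -scalerAl -scalerAr scalerA (mu_mul HE) eqxx.
  by rewrite mulrC.
by rewrite starZc (mu_star HE) -scalerAl -scalerAr (mu_mul HE) eq_sym lk !scaler0.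
Qed.

End OneSystem.

Lemma mu_prod (X Y : finType) (E : X -> X -> A) (F : Y -> Y -> A) :
  matrix_units E -> matrix_units F ->
  (forall i j k l, E i j * F k l = F k l * E i j) ->
  matrix_units (fun p q : X * Y => E p.1 q.1 * F p.2 q.2).
Proof.
move=> HE HF EF; split=> [[i a] [j b] [k c] [l d]|[i a] [j b]|] /=.
- rewrite mulrA -(mulrA (E i j)) -EF mulrA (mu_mul HE) -mulrA (mu_mul HF).
  by rewrite xpair_eqE; case: eqP => _; case: eqP => _; rewrite ?mulr0 ?mul0r.
- by rewrite starM (mu_star HE) (mu_star HF) EF.
- rewrite -(pair_bigA _ (fun i a => E i i * F a a)) /=.
  under eq_bigr do rewrite -mulr_sumr (mu_sum HF) mulr1.
  exact: mu_sum HE.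
Qed.

End MatrixUnits.

Section MatrixUnitsTransport.
Variables (R : realType) (A D : starAlgType R) (f : A -> D) (X : finType).
Variable E : X -> X -> A.
Hypotheses (hf : star_hom f) (HE : matrix_units E).

Lemma mu_hom : matrix_units (fun i j => f (E i j)).
Proof.
split=> [i j k l|i j|].
- by rewrite -(star_homM hf) (mu_mul HE); case: eqP => _; rewrite ?(star_hom0 hf).
- by rewrite -(star_hom_star hf) (mu_star HE).
- by rewrite -(star_hom_sum hf) (mu_sum HE) (star_hom1 hf).
Qed.

Lemma combin_hom c : f (combin E c) = combin (fun i j => f (E i j)) c.
Proof.
rewrite (star_hom_sum hf); apply: eq_bigr => i _; rewrite (star_hom_sum hf).
by apply: eq_bigr => j _; rewrite (star_homZ hf).
Qed.
End MatrixUnitsTransport.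

Section Spectral.
Local Open Scope sesquilinear_scope.

(** The spectral theorem, with coefficients indexed by the finite type itself
    rather than by ordinals. *)
Lemma spectral_finType (R : realType) (X : finType) (H : X -> X -> R[i]) :
  (forall i j, H i j = conj (H j i)) ->
  exists (V : X -> X -> R[i]) (d : X -> R[i]),
    [/\ orthonormal V, (forall i j, \sum_a V a i * conj (V a j) = (i == j)%:R) &
        forall i j, H i j = \sum_a conj (V a i) * d a * V a j].
Proof.
move=> Hs; pose n := #|X|.
pose M : 'M[R[i]]_n := \matrix_(a, b) H (enum_val a) (enum_val b).
have Mn : M \is normalmx.
  have Mt : M ^t* = M by apply/matrixP => a b; rewrite !mxE -Hs.
  by apply/normalmxP; rewrite Mt.
have Pu := spectral_unitarymx M; have ME := elimT (@orthomx_spectralP _ _ M) Mn.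
rewrite invmx_unitary // in ME; set P := spectralmx M in Pu ME.
have reind (F : X -> R[i]) : \sum_x F x = \sum_(a < n) F (enum_val a).
  by rewrite (reindex (@enum_val X predT)) //; exact: (onW_bij _ (enum_val_bij X)).
exists (fun x i => P (enum_rank x) (enum_rank i)).
exists (fun x => spectral_diag M 0 (enum_rank x)); split.
- move=> i j; move/unitarymxP: (Pu) => /matrixP/(_ (enum_rank i) (enum_rank j)).
  rewrite !mxE (inj_eq enum_rank_inj) => <-; rewrite reind.
  by apply: eq_bigr => a _; rewrite !mxE enum_valK.
- move=> i j; have := mulmx1C (elimT unitarymxP Pu) => /matrixP/(_ (enum_rank j) (enum_rank i)).
  rewrite !mxE (inj_eq enum_rank_inj) eq_sym => <-; rewrite reind.
  by apply: eq_bigr => a _; rewrite !mxE enum_valK mulrC.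
- move=> i j; have /matrixP/(_ (enum_rank i) (enum_rank j)) := ME.
  rewrite !mxE !enum_rankK => ->; rewrite reind; apply: eq_bigr => a _.
  by rewrite mul_mx_diag !mxE enum_valK.
Qed.
End Spectral.

(** * Eigenvectors for the top eigenvalue *)

Section TopLine.
Variables (R : realType) (A : cstarType R) (X : finType) (E : X -> X -> A).
Hypothesis HE : matrix_units E.

Lemma complex_ge0E (z : R[i]) : 0 <= z -> z = (complex.Re z)%:C /\ 0 <= complex.Re z.
Proof. by case: z => a b; rewrite lecE /= => /andP[/eqP-> ->]. Qed.

(** Diagonalising b^* b shows that its norm is at most its top eigenvalue. The
    labels chi define blocks; as b^* b respects them, each component of a top
    eigenvector in a block is again an eigenvector, and one of them is
    nonzero. In the application the blocks are the characters of the group, and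
    xi then spans an invariant line. *)
Lemma top_line (K : eqType) (chi : X -> K) c (b := combin E c) :
  (forall i j, chi i != chi j -> c i j = 0) ->
  exists (xi : X -> R[i]) (k : K) (lam : R),
    [/\ unit_vector xi, (forall i, chi i != k -> xi i = 0), cnorm b ^+ 2 <= lam &
        line_proj E xi * (star b * b) * line_proj E xi = lam%:C *: line_proj E xi].
Proof.
move=> cchi; pose H i j := \sum_k conj (c k i) * c k j.
have bH : star b * b = combin E H by rewrite (combin_star HE) (combinM HE).
have Hchi i j : chi i != chi j -> H i j = 0.
  move=> ij; apply: big1 => k _; have [ki|ki] := eqVneq (chi k) (chi i).
    by rewrite (cchi k j) ?mulr0 // ki.
  by rewrite cchi // rmorph0 mul0r.
have Hs i j : H i j = conj (H j i).
  by rewrite rmorph_sum; apply: eq_bigr => k _; rewrite rmorphM /= conjCK mulrC.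
have [V [d [oV cV HV]]] := spectral_finType Hs.
have HVd a i : \sum_j H i j * conj (V a j) = d a * conj (V a i).
  transitivity (\sum_b (conj (V b i) * d b) * \sum_j V b j * conj (V a j)).
    under eq_bigr do rewrite HV mulr_suml; rewrite exchange_big /=.
    by apply: eq_bigr => b0 _; rewrite mulr_sumr; apply: eq_bigr => j _; rewrite !mulrA.
  rewrite [LHS](bigD1 a) //= [X in _ + X]big1 ?addr0 => [|b0 /negPf ba]; last by rewrite oV ba mulr0.
  by rewrite oV eqxx mulr1 mulrC.
have d_ge0 a : 0 <= d a.
  have -> : d a = \sum_i V a i * \sum_j H i j * conj (V a j).
    under eq_bigr do rewrite HVd mulrCA; by rewrite -mulr_sumr oV eqxx mulr1.
  pose z k := \sum_j c k j * conj (V a j).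
  have -> : \sum_i V a i * (\sum_j H i j * conj (V a j)) = \sum_k z k * conj (z k).
    transitivity (\sum_i \sum_k (V a i * conj (c k i)) * z k).
      apply: eq_bigr => i _; under eq_bigr do rewrite mulr_suml.
      rewrite exchange_big mulr_sumr; apply: eq_bigr => k _ /=.
      rewrite !mulr_sumr; apply: eq_bigr => j _; by rewrite !mulrA.
    rewrite exchange_big; apply: eq_bigr => k _ /=.
    rewrite rmorph_sum mulr_sumr; apply: eq_bigr => i _.
    by rewrite rmorphM /= conjCK mulrC [conj _ * _]mulrC.
  by apply: sumr_ge0 => k _; exact: mul_conjC_ge0.
have dRe a : d a = (complex.Re (d a))%:C by case: (complex_ge0E (d_ge0 a)).
have [i0 _] := mu_inhabited HE.
have [a dmax] : exists a, forall a', complex.Re (d a') <= complex.Re (d a).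
  by exists [arg max_(a > i0) complex.Re (d a)]%O; case: arg_maxP => // a _ H1 a'; exact: H1.
have lam0 : 0 <= complex.Re (d a) by case: (complex_ge0E (d_ge0 a)).
set lam := complex.Re (d a) in dmax lam0.
have blam : cnorm b ^+ 2 <= lam.
  pose W := rebase E (fun a i => conj (V a i)).
  have HW : matrix_units W.
    apply: rebase_mu => // [i j|i j].
      under eq_bigr do rewrite conjCK mulrC; by rewrite oV eq_sym.
    by under eq_bigr do rewrite conjCK mulrC; rewrite cV eq_sym.
  rewrite -cnorm_star bH; have -> : combin E H = \sum_a d a *: W a a.
    under [RHS]eq_bigr do rewrite combinZ.
    rewrite /combin [RHS]exchange_big; apply: eq_bigr => i _ /=.
    rewrite [RHS]exchange_big; apply: eq_bigr => j _ /=.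
    rewrite -scaler_suml HV; congr (_ *: _); apply: eq_bigr => k _.
    by rewrite conjCK mulrA [d k * _]mulrC.
  apply: cnorm_diag_le => // [i j|i|i].
  - by rewrite (mu_mul HW); case: eqP => // ->.
  - exact: (mu_star HW).
  - by rewrite ger0_norm // dRe lecR.
have [i1 Vi1] : exists i, V a i != 0.
  apply: contrapT => V0; have /eqP := oV a a; rewrite eqxx big1 => [|i _].
    by rewrite eq_sym oner_eq0.
  have [->|Vi] := eqVneq (V a i) 0; first by rewrite mul0r.
  by case: V0; exists i.
(* the component of the eigenvector in the block of i1 *)
pose k := chi i1; pose xi1 i := if chi i == k then conj (V a i) else 0.
have Hxi1 i : \sum_j H i j * xi1 j = lam%:C * xi1 i.
  rewrite -dRe /xi1; case: ifPn => ik.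
    rewrite -HVd; apply: eq_bigr => j _; case: ifPn => // jk.
    by rewrite Hchi ?mul0r // (eqP ik) eq_sym.
  rewrite mulr0 big1 // => j _; case: ifPn => [jk|_]; last by rewrite mulr0.
  by rewrite Hchi ?mul0r // (eqP jk).
pose N2 := \sum_i xi1 i * conj (xi1 i).
have N2p : 0 < N2.
  rewrite /N2 (bigD1 i1) //=; apply: ltr_wpDr.
    by apply: sumr_ge0 => i _; exact: mul_conjC_ge0.
  by rewrite /xi1 eqxx mul_conjC_gt0 conjC_eq0.
have [N2E N2r] := complex_ge0E (ltW N2p).
have N2Rp : 0 < complex.Re N2.
  by rewrite -ltcR -N2E.
set s := Num.sqrt (complex.Re N2).
have sp : 0 < s by rewrite sqrtr_gt0.
pose xi i := (s^-1)%:C * xi1 i.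
have x1 : unit_vector xi.
  rewrite /unit_vector.
  transitivity (((s^-1)%:C * (s^-1)%:C) * N2).
    rewrite mulr_sumr; apply: eq_bigr => i _.
    rewrite /xi rmorphM /= conj_real; ring.
  rewrite N2E -!rmorphM /= -(rmorph1 (real_complex R)); congr (_%:C).
  rewrite -(sqr_sqrtr (ltW N2Rp)) -/s expr2 mulrA -(mulrA s^-1) mulVf ?gt_eqF //.
  by rewrite mulr1 mulVf ?gt_eqF.
exists xi, k, lam; split=> // [i /negPf ik|]; first by rewrite /xi /xi1 ik mulr0.
rewrite bH (line_proj_compress HE); congr (_ *: _).
transitivity (\sum_i lam%:C * (xi i * conj (xi i))); last by rewrite -mulr_sumr x1 mulr1.
apply: eq_bigr => i _.
transitivity ((conj (xi i) * (s^-1)%:C) * \sum_j H i j * xi1 j).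
  by rewrite mulr_sumr; apply: eq_bigr => j _; rewrite /xi; ring.
by rewrite Hxi1 /xi; ring.
Qed.
End TopLine.

(** * The flip and its eigenbasis *)

Section FlipBasis.
Variables (R : realType) (n : nat).

(** Indices of the basis of C^(2n+1) adapted to the block unitary w: the two
    copies of 'I_n label the blocks that w exchanges, None the fixed vector. *)
Definition zidx := option (bool * 'I_n)%type.

Definition flip (z : zidx) : zidx :=
  if z is Some (e, a) then Some (~~ e, a) else None.

Lemma flipK : involutive flip.
Proof. by case=> [[e a]|] //=; rewrite negbK. Qed.

Definition parity (z : zidx) : bool := if z is Some (e, _) then e else false.

Lemma sum_zidx (V : nmodType) (f : zidx -> V) :
  \sum_z f z = f None + \sum_a (f (Some (false, a)) + f (Some (true, a))).
Proof.
rewrite (bigD1 None) //=; congr (_ + _).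
rewrite (reindex_omap Some id) /= => [|[x|]] //.
transitivity (\sum_(p : bool * 'I_n) f (Some (p.1, p.2))).
  by apply: eq_big => [x|[e a] //]; rewrite eqxx.
rewrite -(pair_bigA _ (fun e a => f (Some (e, a)))) /= big_bool -big_split /=.
by apply: eq_bigr => a _; rewrite addrC.
Qed.

(** The eigenbasis of the flip: the vectors (delta_(0,a) + delta_(1,a)) / sqrt 2
    and (delta_(0,a) - delta_(1,a)) / sqrt 2, with eigenvalues 1 and -1, and the
    fixed vector. *)
Definition eigenvector (x y : zidx) : R[i] :=
  match x, y with
  | None, None => 1
  | Some (e, a), Some (d, b) =>
      if a == b then (-1) ^+ (e && d) * (Num.sqrt 2^-1)%:C else 0
  | _, _ => 0
  end.

Lemma eigenvector_real x y : conj (eigenvector x y) = eigenvector x y.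
Proof.
case: x y => [[e a]|] [[d b]|] //=; rewrite ?rmorph0 ?rmorph1 //.
by case: ifP => _; rewrite ?rmorph0 // rmorphM /= conj_real rmorph_sign.
Qed.

Lemma eigenvectorC x y : eigenvector x y = eigenvector y x.
Proof. by case: x y => [[e a]|] [[d b]|] //=; rewrite eq_sym andbC. Qed.

Lemma eigenvector_orthonormal : orthonormal eigenvector.
Proof.
have ss : (Num.sqrt 2^-1)%:C * (Num.sqrt 2^-1)%:C = (2^-1)%:C :> R[i].
  by rewrite -rmorphM /= -expr2 sqr_sqrtr.
have half : (2^-1)%:C + (2^-1)%:C = 1 :> R[i].
  by rewrite -rmorphD -(rmorph1 (real_complex R)) /=; congr (_%:C); lra.
move=> x y; under eq_bigr do rewrite eigenvector_real; rewrite sum_zidx.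
case: x y => [[e a]|] [[d b]|] /=.
- rewrite mulr0 add0r (bigD1 a) //= big1 ?addr0 => [|c /negPf ca]; last first.
    by rewrite eq_sym ca !mul0r addr0.
  have -> : (Some (e, a) == Some (d, b) :> zidx) = (e == d) && (a == b) by [].
  rewrite eqxx [b == a]eq_sym.
  have [_|_] := eqVneq a b; last by rewrite !mulr0 addr0 andbF.
  rewrite !andbF !andbT !expr0 !mul1r ss mulrACA ss -signr_addb.
  by case: e d => [] [] //=; rewrite ?expr0 ?mul1r ?half // expr1 mulN1r subrr.
- by rewrite mul0r big1 ?addr0 // => c _; rewrite !mulr0 addr0.
- by rewrite mulr0 big1 ?addr0 // => c _; rewrite !mul0r addr0.
- by rewrite mulr1 big1 ?addr0 // => c _; rewrite !mul0r addr0.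
Qed.

Lemma eigenvector_complete x y :
  \sum_z eigenvector z x * conj (eigenvector z y) = (x == y)%:R.
Proof.
rewrite -eigenvector_orthonormal; apply: eq_bigr => z _.
by rewrite ![eigenvector z _]eigenvectorC.
Qed.

Lemma eigenvector_flip x y :
  eigenvector x (flip y) = (-1) ^+ parity x * eigenvector x y.
Proof.
case: x y => [[e a]|] [[d b]|] //=; rewrite ?mulr0 ?mulr1 ?expr0 //.
case: ifP => _; last by rewrite mulr0.
by rewrite mulrA -signr_addb; congr ((-1) ^+ _ * _); case: e d => [] [].
Qed.

Section EigenUnits.
Variables (A : starAlgType R) (S : zidx -> zidx -> A).
Hypothesis HS : matrix_units S.

Definition eigen_units := rebase S eigenvector.

Lemma eigen_units_mu : matrix_units eigen_units.
Proof. exact: rebase_mu eigenvector_orthonormal eigenvector_complete. Qed.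

Lemma eigen_units_span x y : in_span eigen_units (S x y).
Proof. by rewrite (rebase_span S x y eigenvector_complete); eexists. Qed.

Lemma eigen_units_None : eigen_units None None = S None None.
Proof.
rewrite -(combin_delta S); apply: eq_combin => x y.
case: x y => [x|] [y|] //=; rewrite ?mul0r ?rmorph0 ?mulr0 //.
by rewrite rmorph1 mulr1.
Qed.

Lemma eigen_units_flip (f : A -> A) x y : star_hom f ->
  (forall a b, f (S a b) = S (flip a) (flip b)) ->
  f (eigen_units x y) = (-1) ^+ (parity x (+) parity y) *: eigen_units x y.
Proof.
move=> hf fS; rewrite /eigen_units /rebase (combin_hom _ hf) combinZ /combin.
rewrite (reindex_inj (inv_inj flipK)); apply: eq_bigr => a _ /=.
rewrite (reindex_inj (inv_inj flipK)); apply: eq_bigr => b _ /=.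
rewrite fS !flipK; congr (_ *: _).
rewrite !eigenvector_flip rmorphM /= rmorph_sign signr_addb; ring.
Qed.
End EigenUnits.

End FlipBasis.

Section FlipMatrix.
Variables (R : realType) (k : nat).
Local Notation Z := (zidx (r k)).

Definition pos (z : Z) : 'I_((3 ^ k).-1.+1) :=
  cast_ord (r_dim k) (match z with
    | None => rshift (r k + r k) ord0
    | Some (false, a) => lshift 1 (lshift (r k) a)
    | Some (true, a) => lshift 1 (rshift (r k) a)
    end).

Lemma pos_bij : bijective pos.
Proof.
apply: inj_card_bij; last first.
  by rewrite card_ord card_option card_prod card_bool card_ord -r_dim mul2n addnn addn1.
move=> x y /cast_ord_inj.
case: x y => [[[] a]|] [[[] b]|] // /eqP;
  rewrite ?(inj_eq (@lshift_inj _ _)) ?(inj_eq (@rshift_inj _ _))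
    ?eq_lrshift ?eq_rlshift ?eq_lshift ?eq_rshift //.
- by move/eqP->.
- by move/eqP->.
Qed.

Definition std_unit (x y : Z) : M3 R k := delta_mx (pos x) (pos y).

Lemma sum_pos (V : nmodType) (f : 'I_((3 ^ k).-1.+1) -> V) :
  \sum_i f i = \sum_z f (pos z).
Proof. by rewrite (reindex pos) //; exact: onW_bij pos_bij. Qed.

Lemma std_unit_mu : matrix_units std_unit.
Proof.
split=> [a b c d|a b|].
- rewrite /std_unit; have [<-|/negPf bc] := eqVneq b c; first exact: mul_delta_mx.
  by apply: mul_delta_mx_0; rewrite (inj_eq (bij_inj pos_bij)) bc.
- apply/matrixP => i j'; rewrite !mxE.
  by rewrite andbC; case: andP => _; rewrite ?rmorph1 ?rmorph0.
- apply/matrixP => i j'; rewrite summxE !mxE -(sum_pos (fun c => delta_mx c c i j')).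
  rewrite (bigD1 i) //= big1 ?addr0 => [|c /negPf ci]; last by rewrite mxE eq_sym ci.
  by rewrite mxE eqxx eq_sym.
Qed.

Lemma std_unit_span (M : M3 R k) : M = combin std_unit (fun x y => M (pos x) (pos y)).
Proof.
rewrite {1}(matrix_sum_delta M) sum_pos; apply: eq_bigr => x _.
by rewrite sum_pos.
Qed.

Lemma w_flip : w R k = \sum_z std_unit (flip z) z.
Proof.
rewrite [LHS]std_unit_span /combin exchange_big; apply: eq_bigr => y _ /=.
have wE x : w R k (pos x) (pos y) = (x == flip y)%:R.
  rewrite /w castmxE /= !cast_ordK.
  case: x y => [[[] a]|] [[[] b]|];
    rewrite ?block_mxEul ?block_mxEur ?block_mxEdl ?block_mxEdr !mxE //=.
rewrite (bigD1 (flip y)) //= big1 ?addr0 => [|x /negPf xy]; last first.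
  by rewrite wE xy scale0r.
by rewrite wE eqxx scale1r.
Qed.

Lemma w_unitary : w R k * star (w R k) = 1.
Proof.
rewrite w_flip star_sum mulr_suml.
rewrite -(mu_sum std_unit_mu) (reindex_inj (inv_inj (@flipK _))).
apply: eq_bigr => z _ /=; rewrite mulr_sumr (bigD1 (flip z)) //= big1 ?addr0.
  by rewrite (mu_star std_unit_mu) (mu_mul std_unit_mu) eqxx !flipK.
by move=> y /negPf yz; rewrite (mu_star std_unit_mu) (mu_mul std_unit_mu) eq_sym yz.
Qed.

Lemma Ad_w_std_unit x y : Ad (w R k) (std_unit x y) = std_unit (flip x) (flip y).
Proof.
rewrite /Ad w_flip star_sum mulr_suml (bigD1 x) //= big1 ?addr0 => [|z /negPf zx].
  rewrite (mu_mul std_unit_mu) eqxx mulr_sumr (bigD1 y) //= big1 ?addr0.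
    by rewrite (mu_star std_unit_mu) (mu_mul std_unit_mu) eqxx.
  move=> z /negPf zy; rewrite (mu_star std_unit_mu) (mu_mul std_unit_mu) eq_sym zy //.
by rewrite (mu_mul std_unit_mu) zx.
Qed.
End FlipMatrix.

(** * Ordered products of commuting factors *)

Section OrderedProducts.
Variables (R : realType) (A : starAlgType R).

Lemma prod_ord_eq0 N (a : 'I_N -> A) m : a m = 0 -> \prod_i a i = 0.
Proof.
elim: N a m => [|N IH] a m a0; first by case: m a0.
rewrite big_ord_recr /=; have [mN|mN] := unliftP ord_max m; last first.
  by rewrite -mN a0 mulr0.
move=> E; rewrite (IH (fun i => a (widen_ord (leqnSn N) i)) mN) ?mul0r //.
by rewrite -a0 E; congr a; apply: val_inj; rewrite /= /bump leqNgt ltn_ord.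
Qed.

Lemma comm_prod N (a : 'I_N -> A) z : (forall i, z * a i = a i * z) ->
  z * \prod_i a i = (\prod_i a i) * z.
Proof.
move=> H; elim/big_ind: _ => [|x y zx zy|i _]; last exact: H.
  by rewrite mulr1 mul1r.
by rewrite mulrA zx -!mulrA zy.
Qed.

Lemma prod_ord_mul N (a b : 'I_N -> A) :
  (forall i l, i != l -> a i * b l = b l * a i) ->
  (\prod_i a i) * (\prod_i b i) = \prod_i (a i * b i).
Proof.
elim: N a b => [|N IH] a b H; first by rewrite !big_ord0 mulr1.
rewrite !big_ord_recr /= mulrA -(mulrA (\prod_i _)) comm_prod => [|i]; last first.
  by rewrite H // -val_eqE /= gtn_eqF.
rewrite mulrA IH -?mulrA // => i l il; apply: H.
by apply: contra il => /eqP/(congr1 val) /= il; apply/eqP/val_inj.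
Qed.

Lemma prod_ord_star N (a : 'I_N -> A) :
  (forall i l, i != l -> star (a i) * star (a l) = star (a l) * star (a i)) ->
  star (\prod_i a i) = \prod_i star (a i).
Proof.
elim: N a => [|N IH] a H; first by rewrite !big_ord0 star1.
rewrite !big_ord_recr /= starM IH => [|i l il]; last first.
  apply: H; by apply: contra il => /eqP/(congr1 val) /= il; apply/eqP/val_inj.
by apply: comm_prod => i; rewrite H // -val_eqE /= gtn_eqF.
Qed.

(** Matrix units of a tensor product. The product is ordered because the
    ambient ring is not commutative, but the order is immaterial. *)
Lemma mu_tensor N (Z : finType) (E : 'I_N -> Z -> Z -> A) :
  (forall m, matrix_units (E m)) ->
  (forall m l x y z t, m != l -> E m x y * E l z t = E l z t * E m x y) ->
  matrix_units (fun s t : {ffun 'I_N -> Z} => \prod_m E m (s m) (t m)).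
Proof.
move=> HE EE; split=> [s t u v|s t|].
- rewrite prod_ord_mul => [|i l il]; last exact: EE.
  have [<-|tu] := eqVneq t u.
    by apply: eq_bigr => m _; rewrite (mu_mul (HE m)) eqxx.
  have [m tum] : exists m, t m != u m.
    apply: contrapT => H; case/eqP: tu; apply/ffunP => m.
    by apply/eqP; apply: contrapT => /negP tum; apply: H; exists m.
  by apply: (@prod_ord_eq0 _ _ m); rewrite (mu_mul (HE m)) (negPf tum).
- rewrite prod_ord_star => [|i l il]; last by rewrite !(mu_star (HE _)) EE.
  by apply: eq_bigr => m _; rewrite (mu_star (HE m)).
- rewrite -(bigA_distr_bigA (fun m z => E m z z)) /=.
  by rewrite big1 // => m _; rewrite (mu_sum (HE m)).
Qed.
End OrderedProducts.

(** * Counting *)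

Section Counting.

Lemma injection_on (X Y : finType) (D : pred X) (y0 : Y) : (#|D| <= #|Y|)%N ->
  exists f : X -> Y, {in D &, injective f}.
Proof.
move=> le; exists (fun x => nth y0 (enum Y) (index x (enum D))) => x y xD yD.
have ix z : z \in D -> (index z (enum D) < size (enum Y))%N.
  move=> zD; rewrite -cardE; apply: leq_trans le.
  by rewrite cardE index_mem mem_enum.
move/eqP; rewrite nth_uniq ?ix ?enum_uniq // => /eqP E.
rewrite -[x](nth_index x (s := enum D)) ?mem_enum // E.
by rewrite nth_index ?mem_enum.
Qed.

(** The left-hand power difference counts the basis vectors of the N-fold tensor
    power with a coordinate fixed by the flip. It is of order n^(N-1), whatever
    the constant L. *)
Lemma power_gap L N : exists R0, forall n, (R0 <= n)%N ->
  (L * ((2 * n).+1 ^ N - (2 * n) ^ N) <= n ^ N)%N.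
Proof.
elim: N L => [|N IH] L; first by exists 0 => n _; rewrite !expn0 subnn muln0.
have [R0 H] := IH (6 * L)%N; exists (maxn R0 (2 * L * 2 ^ N).+1) => n.
rewrite geq_max => /andP[/H {}H n2]; rewrite !expnS.
have le : ((2 * n) ^ N <= (2 * n).+1 ^ N)%N by case: (N) => [//|N']; rewrite leq_exp2r.
rewrite expnMn in le H *; move: H le n2.
set a := ((2 * n).+1 ^ N)%N; set c := (n ^ N)%N; set d := (2 ^ N)%N => H le n2.
have -> : ((2 * n).+1 * a - 2 * n * (d * c) = (2 * n).+1 * (a - d * c) + d * c)%N.
  by rewrite -{1}(subnK le); nia.
set x := (a - d * c)%N in H *.
have h1 : (2 * (L * ((2 * n).+1 * x)) <= n * c)%N.
  apply: (@leq_trans (n * (6 * L * x))%N); last by rewrite leq_mul2l H orbT.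
  have : ((2 * n).+1 <= 3 * n)%N by lia.
  move=> h; have : ((2 * n).+1 * (2 * L * x) <= 3 * n * (2 * L * x))%N by rewrite leq_mul2r h orbT.
  by nia.
have h2 : (2 * (L * (d * c)) <= n * c)%N.
  have : (2 * L * d * c <= n * c)%N by rewrite leq_mul2r (ltnW n2) orbT.
  by nia.
rewrite mulnDr; lia.
Qed.

Lemma leq_r k : (k <= r k)%N.
Proof.
rewrite /r; have H : (2 * k < 3 ^ k)%N.
  elim: k => [//|k IH]; rewrite expnS; lia.
by rewrite geq_half_double -muln2; lia.
Qed.

Variables (N n : nat).

Definition has_fixed (t : {ffun 'I_N -> zidx n}) : bool := [exists m, t m == None].

Lemma card_has_fixed : #|has_fixed| = ((2 * n).+1 ^ N - (2 * n) ^ N)%N.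
Proof.
have cz : #|{: zidx n}| = (2 * n).+1.
  by rewrite card_option card_prod card_bool card_ord.
rewrite -[LHS](addnK #|predC has_fixed|) cardC card_ffun cz card_ord; congr (_ - _)%N.
have -> : #|predC has_fixed| = #|ffun_on (predC1 (None : zidx n)) : {pred {ffun 'I_N -> zidx n}}|.
  apply: eq_card => t; rewrite !inE /has_fixed negb_exists.
  by apply/forallP/ffun_onP => H m; have := H m; rewrite !inE.
rewrite card_ffun_on card_ord; congr (_ ^ _)%N.
by rewrite cardC1 cz.
Qed.
End Counting.

(** * Continuous functions on the group *)

Section UniformContinuity.
Variable R : realType.
Implicit Types (f : contC R Z2prod) (g h : Z2prod).

Lemma near_coord n g : \forall h \near g, h n = g n.
Proof.
have := @proj_continuous _ (fun _ : nat => bool) n g.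
by move=> /discrete_cvg; apply.
Qed.

(** Otherwise there are, for each N, pairs agreeing up to N on which f differs
    by more than e. By compactness they have a cluster point, which lies on the
    diagonal and contradicts the continuity of f there. *)
Lemma contC_unif f (e : R) : 0 < e -> exists N, forall g h,
  (forall n, (n < N)%N -> g n = h n) -> `|f g - f h| <= e%:C.
Proof.
move=> e0; apply: contrapT => H.
have /choice[u Hu] : forall N : nat, exists gh : Z2prod * Z2prod,
    (forall n, (n < N)%N -> gh.1 n = gh.2 n) /\ ~ (`|f gh.1 - f gh.2| <= e%:C).
  move=> N; apply: contrapT => HN; apply: H; exists N => g h gh.
  by apply: contrapT => H'; apply: HN; exists (g, h).
have cK : compact [set: Z2prod * Z2prod].
  by rewrite -setXTT; apply: compact_setX; exact: cantor_space_compact.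
have [[g h] [_ gh]] := cK (u @ \oo) _ filterT.
have tail N : (u @ \oo) [set p | forall n, (n < N)%N -> p.1 n = p.2 n].
  exists N => // M /= NM n nN; apply: (Hu M).1; exact: leq_trans NM.
have ghE : g = h.
  apply/funext => n.
  have U : nbhs (g, h) [set p : Z2prod * Z2prod | p.1 n = g n /\ p.2 n = h n].
    exists ([set g' : Z2prod | g' n = g n], [set h' : Z2prod | h' n = h n]).
      by split; exact: near_coord.
    by [].
  have [p [/= p12 [<- <-]]] := gh _ _ (tail n.+1) U.
  exact: p12.
have e2 : 0 < (e / 2)%:C :> R[i] by rewrite ltcR divr_gt0.
have cf := @contC_cont _ _ f g.
have /= cfe := (proj1 (@cvgrPdist_lt _ R[i]^o _ _ _ _ _)) cf _ e2.
have U : nbhs (g, h) [set p : Z2prod * Z2prod |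
    `|f g - f p.1| < (e / 2)%:C /\ `|f g - f p.2| < (e / 2)%:C].
  rewrite -ghE; exists ([set g' : Z2prod | `|f g - f g'| < (e / 2)%:C],
                 [set g' : Z2prod | `|f g - f g'| < (e / 2)%:C]).
    by split; exact: cfe.
  by [].
have bad : (u @ \oo) [set p | ~ (`|f p.1 - f p.2| <= e%:C)].
  by exists 0 => // M _; exact: (Hu M).2.
have [p [/= pb [p1 p2]]] := gh _ _ bad U; apply: pb.
rewrite -[f p.1 - f p.2](subrKA (f g)) (le_trans (ler_normD _ _)) //.
rewrite (_ : e%:C = (e / 2)%:C + (e / 2)%:C); last first.
  by rewrite -rmorphD /=; congr (_%:C); lra.
by rewrite lerD // ltW // distrC.
Qed.

(** A representative of the coset of the sequences with first coordinates h. *)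
Definition extend N (h : {ffun 'I_N -> bool}) : Z2prod :=
  fun n => if insub n is Some m then h m else false.

Lemma extendE N (h : {ffun 'I_N -> bool}) (m : 'I_N) : extend h m = h m.
Proof. by rewrite /extend valK. Qed.

Lemma contC_bounded f : exists M : nat, forall g, `|f g| <= M%:R.
Proof.
have [N HN] := contC_unif f ltr01.
pose C := 1 + \sum_(h : {ffun 'I_N -> bool}) complex.Re `|f (extend h)|.
exists (Num.bound C) => g; pose h := [ffun m : 'I_N => g m].
have gh : `|f g - f (extend h)| <= 1%:C.
  by apply: HN => n nN; rewrite -[n]/(val (Ordinal nN)) extendE ffunE.
have fC : `|f g| <= C%:C.
  have := ler_normD (f g - f (extend h)) (f (extend h)); rewrite subrK => /le_trans; apply.
  rewrite rmorphD /=; apply: lerD => //.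
  have nE z : `|z| = (complex.Re `|z|)%:C :> R[i] by case: (complex_ge0E (normr_ge0 z)).
  rewrite nE lecR (bigD1 h) //= lerDl; apply: sumr_ge0 => h' _.
  by case: (complex_ge0E (normr_ge0 (f (extend h')))).
apply: le_trans fC _; rewrite -(rmorph_nat (real_complex R)) lecR ltW //.
apply: archi_boundP; apply: addr_ge0 => //; apply: sumr_ge0 => h' _.
by case: (complex_ge0E (normr_ge0 (f (extend h')))).
Qed.

End UniformContinuity.

Lemma finite_set_uniform (T : choiceType) (F : set T) (Q : T -> nat -> Prop) :
  finite_set F -> (forall x, F x -> exists n, forall m, (n <= m)%N -> Q x m) ->
  exists n, forall x, F x -> forall m, (n <= m)%N -> Q x m.
Proof.
move=> /finite_seqP[s ->] H.
have {}H : forall x, x \in s -> exists n, forall m, (n <= m)%N -> Q x m := H.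
suff [n Hn] : exists n, forall x, x \in s -> forall m, (n <= m)%N -> Q x m by exists n.
elim: s H => [|y s IH] H; first by exists 0.
have [|n Hn] := IH; first by move=> x xs; apply: H; rewrite inE xs orbT.
have [n' Hn'] := H y (mem_head _ _).
exists (maxn n n') => x; rewrite inE => /orP[/eqP->|xs] m.
  by rewrite geq_max => /andP[_]; exact: Hn'.
by rewrite geq_max => /andP[+ _]; exact: Hn.
Qed.

(** * Compression by the line of a top eigenvector *)

Section Compression.
Variables (R : realType) (A : cstarType R).
Implicit Types (b c q : A).

Lemma sqr_norm_dist b c :
  cnorm (star b * b - star c * c) <= cnorm (b - c) * (cnorm b + cnorm c).
Proof.
have -> : star b * b - star c * c = star b * (b - c) + star (b - c) * c.
  by rewrite starB mulrBr mulrBl addrA subrK.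
have := cnorm_triangle (star b * (b - c)) (star (b - c) * c).
have := cnormM (star b) (b - c); have := cnormM (star (b - c)) c.
rewrite !cnormV; lra.
Qed.

Lemma cnorm_compress q b : projection q -> cnorm (q * b * q) <= cnorm b.
Proof.
move=> pq; have q1 := cnorm_proj_le1 pq.
have := cnormM3_le q b q; have := cnorm_ge0 b; have := cnorm_ge0 q.
have : cnorm q * cnorm b <= cnorm b by rewrite ler_piMl ?cnorm_ge0.
have := mulr_ge0 (cnorm_ge0 q) (cnorm_ge0 b) => h0 h1.
have : cnorm q * cnorm b * cnorm q <= cnorm q * cnorm b by rewrite ler_piMr.
lra.
Qed.

(** The compression of c^* c by q is lam q with lam at least the square of the
    norm of c. The compression of b^* b is therefore closer to lam q than lam,
    and the Newton iteration starts at lam^(-1/2) q. The constant 8 leaves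
    enough room for this. *)
Lemma cuntz_sub_top_line (S : set A) b c q (lam : R) : star_subalgebra S ->
  projection q -> S q -> S (star b * b) -> b <> 0 ->
  cnorm (b - c) <= cnorm b / 8 -> cnorm c ^+ 2 <= lam ->
  q * (star c * c) * q = lam%:C *: q -> cuntz_sub S q (star b * b).
Proof.
move=> HS pq Sq Sb b0 bc lc qc; have [qs qq] := pq.
have nb := cnorm_gt0 b0; have nc := cnorm_ge0 c.
have c1 := cnorm_le_dist b c; have c2 := cnorm_le_dist c b; rewrite cnormC in c2.
have lam0 : 0 < lam by apply: lt_le_trans lc; rewrite exprn_gt0 //; lra.
set s := (Num.sqrt lam)^-1.
have ss : s * s = lam^-1 by rewrite /s -invfM -expr2 sqr_sqrtr // ltW.
apply: (cuntz_newton (v0 := s%:C *: q)) => //.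
- by rewrite starM starK.
- by rewrite -scalerAr qq.
- exact: ssa_scale.
have -> : q - s%:C *: q * (star b * b) * star (s%:C *: q) =
    (lam^-1)%:C *: (q * (star c * c - star b * b) * q).
  rewrite starZr qs -scalerAr -!scalerAl scalerA -rmorphM /= ss.
  rewrite mulrBr mulrBl qc scalerBr scalerA -rmorphM /= mulVf ?gt_eqF //.
  by rewrite rmorph1 scale1r.
rewrite cnormZr gtr0_norm ?invr_gt0 // mulrC ltr_pdivrMr // mul1r.
apply: le_lt_trans (cnorm_compress _ pq) _; rewrite cnormC.
have := sqr_norm_dist b c; have := cnorm_ge0 (b - c); nra.
Qed.
End Compression.

(** * The tensor product algebra and its finite levels *)

Section TensorBasics.
Variables (R : realType) (D : nat -> starAlgType R) (A : cstarType R).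
Variable j : forall k, D k -> A.
Hypothesis Hj : infinite_tensor_product j.

Lemma elementary_tensor_single k (x : D k) :
  elementary_tensor j k.+1 (eqtype.dfwith (fun l => 1 : D l) x) = j x.
Proof.
rewrite /elementary_tensor big_ord_recr /= eqtype.dfwith_in big1 ?mul1r // => l _.
rewrite eqtype.dfwith_out; first exact: star_hom1 (itp_hom Hj _).
by rewrite neq_ltn ltn_ord orbT.
Qed.

Lemma tensor_map_single (f : forall k, D k -> D k) (F : A -> A) k (x : D k) :
  (forall k, f k 1 = 1) -> is_tensor_map j f F -> F (j x) = j (f k x).
Proof.
move=> f1 HF; rewrite -elementary_tensor_single HF -elementary_tensor_single.
rewrite /elementary_tensor; apply: eq_bigr => l _; congr (j _).
have [E|kl] := eqVneq k l; last by rewrite !eqtype.dfwith_out.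
by case: (nat_of_ord l) / E; rewrite !eqtype.dfwith_in.
Qed.
End TensorBasics.

Section Setting.
Variables (R : realType) (B : cstarType R) (iota : forall k : nat, M3 R k.+1 -> B).
Hypothesis HB : infinite_tensor_product iota.
Variable nu : B -> B.
Hypothesis nu_tensor : is_tensor_map iota (fun k => Ad (w R k.+1)) nu.
Variables (A : cstarType R) (j : nat -> B -> A).
Hypothesis HA : @infinite_tensor_product R (fun=> B) A j.
Variable alpha : Z2prod -> A -> A.
Hypothesis alpha_action : continuous_action alpha.
Hypothesis nu_aut : star_automorphism nu.
Hypothesis alpha_tensor : forall g : Z2prod,
  @is_tensor_map R (fun=> B) A j (fun n => Z2_action nu (g n)) (alpha g).
Implicit Types (n k l N K : nat) (g : Z2prod) (a b : A).

Definition factor n k (X : M3 R k.+1) : A := j n (iota X).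

Lemma factor_hom n k : star_hom (@factor n k).
Proof.
have hj := itp_hom HA n; have hi := itp_hom HB k; rewrite /factor; split.
- by move=> c x y; rewrite (star_homD hi) (star_homZ hi) (star_homD hj) (star_homZ hj).
- by move=> x y; rewrite (star_homM hi) (star_homM hj).
- by rewrite (star_hom1 hi) (star_hom1 hj).
- by move=> x; rewrite (star_hom_star hi) (star_hom_star hj).
Qed.

Lemma factor_comm n k n' k' (X : M3 R k.+1) (Y : M3 R k'.+1) : (n, k) != (n', k') ->
  factor n X * @factor n' k' Y = factor n' Y * @factor n k X.
Proof.
rewrite xpair_eqE negb_and /factor; have [<-|nn] := eqVneq n n' => /= kk.
  have hj := itp_hom HA n.
  by rewrite -!(star_homM hj) (itp_comm HB _ _ kk).
exact: (itp_comm HA _ _ nn).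
Qed.

Lemma alpha_hom g : star_hom (alpha g).
Proof. by have [] := action_aut alpha_action g. Qed.

Lemma nu_iota k (X : M3 R k.+1) : nu (iota X) = iota (Ad (w R k.+1) X).
Proof.
apply: (tensor_map_single HB X _ nu_tensor) => l.
by rewrite /Ad mulr1 w_unitary.
Qed.

Lemma alpha_factor g n k (X : M3 R k.+1) :
  alpha g (@factor n k X) = factor n (if g n then Ad (w R k.+1) X else X).
Proof.
rewrite /factor (tensor_map_single HA (iota X) _ (alpha_tensor g)) => [|m].
  by rewrite /Z2_action; case: (g n) => //; rewrite nu_iota.
by rewrite /Z2_action; case: (g m) => //; case: nu_aut => /star_hom1.
Qed.

(** Matrix units of the factor M_(3^(k+1)) in the n-th copy of B. The first
    family is permuted by the action, the second one consists of eigenvectors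
    of the action. *)
Definition flip_units n k (x y : zidx (r k.+1)) : A := factor n (std_unit R x y).
Definition char_units n k := eigen_units (flip_units n (k := k)).

Lemma flip_units_mu n k : matrix_units (@flip_units n k).
Proof. exact: mu_hom (factor_hom n k) (std_unit_mu R k.+1). Qed.

Lemma char_units_mu n k : matrix_units (@char_units n k).
Proof. exact: eigen_units_mu (flip_units_mu n k). Qed.

Lemma alpha_flip_units g n k x y :
  alpha g (@flip_units n k x y) = if g n then flip_units n (flip x) (flip y) else flip_units n x y.
Proof. by rewrite /flip_units alpha_factor; case: (g n); rewrite // Ad_w_std_unit. Qed.

Lemma alpha_char_units g n k x y : alpha g (@char_units n k x y) =
  ((-1) ^+ (g n && parity x) * (-1) ^+ (g n && parity y)) *: char_units n x y.
Proof.
have [gn|gn] := boolP (g n) => /=.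
  rewrite -signr_addb; apply: eigen_units_flip (alpha_hom g) _ => a b.
  by rewrite alpha_flip_units gn.
rewrite mul1r scale1r /char_units /eigen_units /rebase (combin_hom _ (alpha_hom g)).
apply: eq_bigr => a _; apply: eq_bigr => b _.
by rewrite alpha_flip_units (negPf gn).
Qed.

Lemma factor_span_char n k (X : M3 R k.+1) : in_span (@char_units n k) (factor n X).
Proof.
rewrite [X]std_unit_span (combin_hom _ (factor_hom n k)).
apply: (in_span_sum (char_units_mu n k)) => x _.
apply: (in_span_sum (char_units_mu n k)) => y _; apply: in_spanZ.
exact: eigen_units_span (flip_units n (k := k)) x y.
Qed.

Definition commutes_with z a := z * a = a * z.

Lemma commutes_sum (I : Type) (s : seq I) (P : pred I) (F : I -> A) z :
  (forall i, P i -> commutes_with z (F i)) ->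
  commutes_with z (\sum_(i <- s | P i) F i).
Proof.
move=> H; elim/big_ind: _ => //; rewrite /commutes_with.
  by rewrite mulr0 mul0r.
by move=> x y zx zy; rewrite mulrDl mulrDr zx zy.
Qed.

Lemma commutesZ z c a : commutes_with z a -> commutes_with z (c *: a).
Proof. by rewrite /commutes_with -scalerAl -scalerAr => ->. Qed.

Lemma commutesM z a b :
  commutes_with z a -> commutes_with z b -> commutes_with z (a * b).
Proof. by rewrite /commutes_with => za zb; rewrite mulrA za -!mulrA zb. Qed.

Lemma commutes_combin (X : finType) (E : X -> X -> A) c z :
  (forall x y, commutes_with z (E x y)) -> commutes_with z (combin E c).
Proof.
by move=> H; apply: commutes_sum => x _; apply: commutes_sum => y _; apply: commutesZ.
Qed.

Lemma commutes_char_units n k z x y :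
  (forall X, commutes_with z (@factor n k X)) -> commutes_with z (@char_units n k x y).
Proof. by move=> H; apply: commutes_combin => a b; apply: H. Qed.

(** Stars are left out of the closure conditions: the generators are already
    stable under them. *)
Inductive level N K : A -> Prop :=
| level_gen n k X : (n < N)%N -> (k < K)%N -> level N K (@factor n k X)
| level_1 : level N K 1
| level_add a b : level N K a -> level N K b -> level N K (a + b)
| level_mul a b : level N K a -> level N K b -> level N K (a * b)
| level_scale (c : R[i]) a : level N K a -> level N K (c *: a).

Lemma level_mono N K N' K' a : (N <= N')%N -> (K <= K')%N ->
  level N K a -> level N' K' a.
Proof.
move=> NN KK; elim=> [n k X nN kK||*|*|*].
- by apply: level_gen; [exact: leq_trans NN | exact: leq_trans KK].
- exact: level_1.
- exact: level_add.
- exact: level_mul.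
- exact: level_scale.
Qed.

Lemma level_commutes N K a z :
  (forall n k X, (k < K)%N -> commutes_with z (@factor n k X)) ->
  level N K a -> commutes_with z a.
Proof.
move=> H; elim=> [n k X _ kK||x y _ IHx _ IHy|x y _ IHx _ IHy|c x _ IH].
- exact: H.
- by rewrite /commutes_with mulr1 mul1r.
- by rewrite /commutes_with mulrDl mulrDr IHx IHy.
- exact: commutesM.
- exact: commutesZ.
Qed.

Definition approximable a := forall e : R, 0 < e ->
  exists N K b, level N K b /\ cnorm (a - b) < e.

Lemma approximableM a b : approximable a -> approximable b -> approximable (a * b).
Proof.
move=> Ha Hb e e0; pose M := cnorm a + cnorm b + 1.
have M1 : 1 <= M by have := cnorm_ge0 a; have := cnorm_ge0 b; rewrite /M; lra.
pose d := Num.min 1 (e / (2 * M)).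
have eM : 0 < e / (2 * M) by rewrite divr_gt0 //; lra.
have d0 : 0 < d by rewrite lt_min ltr01.
have d1 : d <= 1 by rewrite ge_min lexx.
have dM : d * (2 * M) <= e by rewrite -ler_pdivlMr ?ge_min ?lexx ?orbT //; lra.
have [N [K [a' [La ab]]]] := Ha d d0; have [N' [K' [b' [Lb bb]]]] := Hb d d0.
exists (maxn N N'), (maxn K K'), (a' * b'); split.
  by apply: level_mul; [apply: level_mono La|apply: level_mono Lb];
    rewrite ?leq_maxl ?leq_maxr.
have -> : a * b - a' * b' = a * (b - b') + (a - a') * b'.
  by rewrite mulrBr mulrBl addrA subrK.
apply: le_lt_trans (cnorm_triangle _ _) _.
have := cnormM a (b - b'); have := cnormM (a - a') b'.
have := cnorm_le_dist b' b; rewrite cnormC => b'b.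
have := ler_wpM2l (cnorm_ge0 a) (ltW bb).
have : cnorm (a - a') * cnorm b' <= d * (cnorm b + 1).
  by apply: ler_pM (cnorm_ge0 _) (cnorm_ge0 _) (ltW ab) _; lra.
rewrite /M in dM; have : 0 < d * 1 by rewrite mulr1.
lra.
Qed.

Lemma approximableD a b : approximable a -> approximable b -> approximable (a + b).
Proof.
move=> Ha Hb e e0; have e2 : 0 < e / 2 by rewrite divr_gt0.
have [N [K [a' [La ab]]]] := Ha _ e2; have [N' [K' [b' [Lb bb]]]] := Hb _ e2.
exists (maxn N N'), (maxn K K'), (a' + b'); split.
  by apply: level_add; [apply: level_mono La|apply: level_mono Lb];
    rewrite ?leq_maxl ?leq_maxr.
rewrite opprD addrACA; have := cnorm_triangle (a - a') (b - b'); lra.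
Qed.

Lemma level_approximable N K a : level N K a -> approximable a.
Proof. by move=> La e e0; exists N, K, a; rewrite subrr cnorm0. Qed.

Lemma approximable_j n x : approximable (j n x).
Proof.
move=> e e0; have [K [xs Hxs]] := itp_dense HB x e0; have hj := itp_hom HA n.
exists n.+1, K, (\sum_(y <- xs) j n (elementary_tensor iota K y)); split.
  elim/big_ind: _ => [||y _]; last 1 first.
  - rewrite (star_hom_prod hj); elim/big_ind: _ => [||k _].
    + exact: level_1.
    + exact: level_mul.
    + by apply: level_gen.
  - by rewrite -(scale0r 1); apply: level_scale; exact: level_1.
  - exact: level_add.
rewrite -(star_hom_sum hj) -(star_homB hj).
exact: le_lt_trans (star_hom_contractive hj _) Hxs.
Qed.

(** The density conditions for A and for B combine because the embeddings of B
    are contractive. *)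
Lemma level_dense a : approximable a.
Proof.
move=> e e0; have e2 : 0 < e / 2 by rewrite divr_gt0.
have [n [xs Hxs]] := itp_dense HA a e2.
have Hs : approximable (\sum_(x <- xs) elementary_tensor j n x).
  elim/big_ind: _ => [||x _]; last 1 first.
  - rewrite /elementary_tensor; elim/big_ind: _ => [||k _]; last exact: approximable_j.
    + exact: level_approximable (level_1 0 0).
    + exact: approximableM.
  - rewrite -(scale0r 1); exact: level_approximable (level_scale _ (level_1 0 0)).
  - exact: approximableD.
have [N [K [b [Lb Hb]]]] := Hs _ e2; exists N, K, b; split=> //.
have := cnorm_tri3 a (\sum_(x <- xs) elementary_tensor j n x) b; lra.
Qed.

(** The characters of (Z/2)^N, as sign-valued functions on the whole group. *)
Definition sgn N (chi : nat -> bool) g : R[i] := \prod_(m < N) (-1) ^+ (chi m && g m).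

Lemma sgnD N chi chi' g :
  sgn N (fun m => chi m (+) chi' m) g = sgn N chi g * sgn N chi' g.
Proof.
rewrite /sgn -big_split; apply: eq_bigr => m _ /=.
by rewrite -signr_addb andb_addl.
Qed.

Lemma sgn_single N n e g : (n < N)%N ->
  sgn N (fun m => (m == n) && e) g = (-1) ^+ (e && g n).
Proof.
move=> nN; rewrite /sgn (bigD1 (Ordinal nN)) //= eqxx big1 ?mulr1 // => m mn.
by rewrite (negPf (_ : (m : nat) != n)) ?expr0.
Qed.

Lemma sgn_sq N chi g : sgn N chi g * sgn N chi g = 1.
Proof.
rewrite -sgnD /sgn big1 // => m _.
by rewrite addbb /= expr0.
Qed.

Lemma eq_sgn N chi chi' g : (forall m, (m < N)%N -> chi m = chi' m) ->
  sgn N chi g = sgn N chi' g.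
Proof. by move=> H; apply: eq_bigr => m _; rewrite H. Qed.

(** Each basis vector x spans an invariant line, with character chi x. *)
Record equivariant_units N (X : finType) (E : X -> X -> A) (chi : X -> nat -> bool)
    : Prop := {
  equ_mu : matrix_units E;
  equ_alpha : forall g x y,
    alpha g (E x y) = (sgn N (chi x) g * sgn N (chi y) g) *: E x y }.

Lemma equivariant_unit N : equivariant_units N (fun _ _ : unit => 1) (fun _ _ => false).
Proof.
split; first split=> [[] [] [] []|_ _|]; rewrite ?mulr1 ?star1 //.
  by rewrite (big_pred1 tt) // => -[].
by move=> g _ _; rewrite (star_hom1 (alpha_hom g)) sgn_sq scale1r.
Qed.

(** Tensoring one factor after the other. The factors outside s must be known to
    commute with the units, both for the induction and for the projection p,
    which lives in such factors. *)
Lemma units_of_factors N (s : seq (nat * nat)) : uniq s ->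
  (forall q, q \in s -> (q.1 < N)%N) ->
  exists (X : finType) (E : X -> X -> A) (chi : X -> nat -> bool),
  [/\ equivariant_units N E chi,
      (forall n k X, (n, k) \in s -> in_span E (@factor n k X)) &
      (forall n k Y x y, (n, k) \notin s -> commutes_with (@factor n k Y) (E x y))].
Proof.
elim: s => [|[n k] s IH] /=.
  move=> _ _; exists unit, (fun _ _ => 1), (fun _ _ => false); split=> //.
    exact: equivariant_unit.
  by move=> n k Y _ _ _; rewrite /commutes_with mulr1 mul1r.
move=> /andP[nks us] sN; have [|X [E [chi [[HE aE] sE cE]]]] := IH us.
  by move=> q qs; apply: sN; rewrite inE qs orbT.
have nN : (n < N)%N by apply: (sN (n, k)); rewrite mem_head.
pose F := @char_units n k; have HF : matrix_units F := char_units_mu n k.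
have EF x y z t : F x y * E z t = E z t * F x y.
  apply/esym; apply: commutes_char_units => Y; apply/esym; exact: cE.
have HEF := mu_prod HF HE EF.
exists (prod (zidx (r k.+1)) X), (fun p q => F p.1 q.1 * E p.2 q.2).
exists (fun p m => ((m == n) && parity p.1) (+) chi p.2 m); split.
- split=> // g [x z] [y t] /=.
  rewrite (star_homM (alpha_hom g)) alpha_char_units aE -scalerAl -scalerAr scalerA.
  rewrite !sgnD !sgn_single // [parity x && _]andbC [parity y && _]andbC.
  by congr (_ *: _); ring.
- have spanF a : in_span F a -> in_span (fun p q => F p.1 q.1 * E p.2 q.2) a.
    move=> [c ->]; apply: (in_span_sum HEF) => x _; apply: (in_span_sum HEF) => y _.
    apply: in_spanZ; rewrite -[F x y]mulr1 -(mu_sum HE) mulr_sumr.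
    apply: (in_span_sum HEF) => z _.
    exact: (in_span_E (fun p q => F p.1 q.1 * E p.2 q.2) (x, z) (y, z)).
  have spanE a : in_span E a -> in_span (fun p q => F p.1 q.1 * E p.2 q.2) a.
    move=> [c ->]; apply: (in_span_sum HEF) => x _; apply: (in_span_sum HEF) => y _.
    apply: in_spanZ; rewrite -[E x y]mul1r -(mu_sum HF) mulr_suml.
    apply: (in_span_sum HEF) => z _.
    exact: (in_span_E (fun p q => F p.1 q.1 * E p.2 q.2) (z, x) (z, y)).
  move=> m l Y; rewrite inE => /orP[/eqP[-> E2]|ml]; last exact: spanE (sE _ _ _ ml).
  by move: Y; rewrite E2 => Y; exact: spanF (factor_span_char _ _).
- move=> m l Y x y; rewrite inE negb_or => /andP[mlnk mls].
  apply: commutesM; last exact: cE.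
  by apply: commutes_char_units => Y'; apply: factor_comm.
Qed.

Lemma level_units N K :
  exists (X : finType) (E : X -> X -> A) (chi : X -> nat -> bool),
  [/\ equivariant_units N E chi, (forall a, level N K a -> in_span E a) &
      (forall n k Y x y, (K <= k)%N -> commutes_with (@factor n k Y) (E x y))].
Proof.
have mem n k : ((n, k) \in [seq (n, k) | n <- seq.iota 0 N, k <- seq.iota 0 K]) =
    (n < N)%N && (k < K)%N.
  apply/allpairsP/andP => [[[n' k'] /= []]|[nN kK]].
    by rewrite !mem_iota => nN kK [-> ->].
  by exists (n, k); rewrite !mem_iota.
have [|[n k]|X [E [chi [HE sE cE]]]] :=
    @units_of_factors N [seq (n, k) | n <- seq.iota 0 N, k <- seq.iota 0 K].
- by apply: allpairs_uniq; rewrite ?iota_uniq // => -[? ?] [? ?].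
- by rewrite mem => /andP[].
exists X, E, chi; split=> //.
  have HE1 := equ_mu HE.
  move=> a; elim=> [n k Y nN kK||b c _ IHb _ IHc|b c _ IHb _ IHc|t b _ IH].
  - by apply: sE; rewrite mem nN.
  - exact: in_span1.
  - exact: in_spanD.
  - exact: in_spanM.
  - exact: in_spanZ.
by move=> n k Y x y Kk; apply: cE; rewrite mem negb_and -!leqNgt Kk orbT.
Qed.

Lemma alpha_norm g a : cnorm (alpha g a) <= cnorm a.
Proof. exact: star_hom_contractive (alpha_hom g) a. Qed.

Lemma fixed_subalgebra : star_subalgebra (fixed alpha).
Proof.
split=> [g|a b fa fb g|a b fa fb g|c a fa g|a fa g].
- exact: star_hom1 (alpha_hom g).
- by rewrite (star_homD (alpha_hom g)) fa fb.
- by rewrite (star_homM (alpha_hom g)) fa fb.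
- by rewrite (star_homZ (alpha_hom g)) fa.
- by rewrite (star_hom_star (alpha_hom g)) fa.
Qed.

(** Averaging over one coordinate of the group after the other makes an
    approximant of a fixed element block diagonal, without moving it away. *)
Lemma average_block_diagonal N (X : finType) (E : X -> X -> A) chi b c :
  equivariant_units N E chi -> fixed alpha b ->
  exists c', (forall x y n, (n < N)%N -> chi x n != chi y n -> c' x y = 0) /\
    cnorm (b - combin E c') <= cnorm (b - combin E c).
Proof.
move=> HE fb; have [HE1 aE] := HE.
suff H M : (M <= N)%N -> exists c',
    (forall x y n, (n < M)%N -> chi x n != chi y n -> c' x y = 0) /\
    cnorm (b - combin E c') <= cnorm (b - combin E c) by exact: H (leqnn N).
elim: M => [|M IH] MN; first by exists c.
have [c' [Hc' le']] := IH (ltnW MN).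
pose g : Z2prod := fun m => m == M.
have sg x : sgn N (chi x) g = (-1) ^+ chi x M.
  rewrite /sgn (bigD1 (Ordinal MN)) //= /g eqxx andbT big1 ?mulr1 // => m mM.
  by rewrite (negPf (_ : (m : nat) != M)) ?andbF.
exists (fun x y => if chi x M == chi y M then c' x y else 0); split.
  move=> x y n; rewrite ltnS leq_eqVlt => /orP[/eqP->|nM] xy; first by rewrite (negPf xy).
  by case: ifP => // _; exact: Hc' nM xy.
have -> : combin E (fun x y => if chi x M == chi y M then c' x y else 0) =
    (2^-1)%:C *: (combin E c' + alpha g (combin E c')).
  have -> : alpha g (combin E c') =
      combin E (fun x y => (-1) ^+ (chi x M (+) chi y M) * c' x y).
    rewrite (combin_hom _ (alpha_hom g)); apply: eq_bigr => x _; apply: eq_bigr => y _.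
    by rewrite aE !sg scalerA -signr_addb mulrC.
  rewrite combinD combinZ; apply: eq_combin => x y.
  have [->|] := eqVneq (chi x M) (chi y M).
    rewrite addbb expr0 mul1r mulrDr -mulrDl -rmorphD /=.
    by rewrite (_ : 2^-1 + 2^-1 = 1) ?rmorph1 ?mul1r //; lra.
  by rewrite negb_eqb => ->; rewrite expr1 mulN1r subrr mulr0.
have -> : b - (2^-1)%:C *: (combin E c' + alpha g (combin E c')) =
    (2^-1)%:C *: ((b - combin E c') + alpha g (b - combin E c')).
  rewrite (star_homB (alpha_hom g)) fb addrACA -opprD scalerBr; congr (_ - _).
  by rewrite scalerDr -scalerDl -rmorphD /= (_ : 2^-1 + 2^-1 = 1) ?scale1r //; lra.
apply: le_trans le'; rewrite cnormZr ger0_norm //.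
have := cnorm_triangle (b - combin E c') (alpha g (b - combin E c')).
have := alpha_norm g (b - combin E c'); lra.
Qed.

(** * The equivariant copy of C((Z/2)^N) *)

Section TensorFactors.
Variables (N k : nat).
Local Notation Z := (zidx (r k.+1)).
Local Notation Y := {ffun 'I_N -> Z}.
Implicit Types (s t : Y) (h : {ffun 'I_N -> bool}) (f : contC R Z2prod).

Lemma commutes_copies (m l : 'I_N) (a b : A) : m != l ->
  in_span (@flip_units m k) a -> in_span (@flip_units l k) b ->
  a * b = b * a.
Proof.
move=> ml [c ->] [d ->]; apply: commutes_combin => x y; apply/esym.
apply: commutes_combin => x' y'; apply: factor_comm.
by rewrite xpair_eqE eq_sym val_eqE (negPf ml).
Qed.

Lemma char_units_span_flip n (x y : Z) : in_span (@flip_units n k) (char_units n x y).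
Proof. by eexists. Qed.

(** Matrix units of the tensor product of the (k+1)-st matrix factors of the
    first N copies. *)
Definition units (s t : Y) : A := \prod_(m < N) char_units m (s m) (t m).

Definition parities t m : bool := if insub m is Some m' then parity (t m') else false.

Lemma paritiesE t (m : 'I_N) : parities t m = parity (t m).
Proof. by rewrite /parities valK. Qed.

Lemma units_equivariant : equivariant_units N units parities.
Proof.
split.
  apply: (mu_tensor (E := fun m : 'I_N => @char_units m k)) => [m|m l x y z t ml]; first exact: char_units_mu.
  apply: (commutes_copies ml); exact: char_units_span_flip.
move=> g s t; rewrite /units (star_hom_prod (alpha_hom g)).
rewrite /sgn -big_split /=.
elim/big_rec3: _ => [|m a b c _ IH]; first by rewrite scale1r.
rewrite IH alpha_char_units -scalerAl -scalerAr scalerA !paritiesE.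
by rewrite ![g m && _]andbC.
Qed.

Let HU : matrix_units units := equ_mu units_equivariant.

Lemma commutes_units z s t :
  (forall m Y, commutes_with z (@factor m k Y)) -> commutes_with z (units s t).
Proof.
move=> H; apply: comm_prod => m; apply: commutes_char_units => Y; exact: H.
Qed.

(** The action of the n-th coordinate exchanges these two projections, which
    makes their span a copy of C(Z/2) with the translation action. *)
Definition half n (b : bool) : A := \sum_(a < r k.+1) flip_units n (Some (b, a)) (Some (b, a)).

Lemma halfM n (b c : bool) : half n b * half n c = if b == c then half n b else 0.
Proof.
rewrite mulr_suml; have [<-|bc] := eqVneq b c.
  apply: eq_bigr => a _; rewrite mulr_sumr (bigD1 a) //= (mu_mul (flip_units_mu n k)) eqxx.
  rewrite big1 ?addr0 // => a' /negPf aa; rewrite (mu_mul (flip_units_mu n k)).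
  by case: eqP => // -[E]; rewrite E eqxx in aa.
rewrite big1 // => a _; rewrite mulr_sumr big1 // => a' _.
by rewrite (mu_mul (flip_units_mu n k)); case: eqP => // -[E]; rewrite E eqxx in bc.
Qed.

Lemma half_star n (b : bool) : star (half n b) = half n b.
Proof. by rewrite star_sum; apply: eq_bigr => a _; rewrite (mu_star (flip_units_mu n k)). Qed.

Lemma half_sum n : half n false + half n true = \sum_(z : Z | z != None) char_units n z z.
Proof.
have := mu_sum (flip_units_mu n k); rewrite sum_zidx big_split /= -/(half n false) -/(half n true).
rewrite -(eigen_units_None (flip_units n (k := k))) -/(@char_units n k) -(mu_sum (char_units_mu n k)).
by rewrite [RHS](bigD1 None) //= => /addrI.
Qed.

Lemma alpha_half g n (b : bool) : alpha g (half n b) = half n (b (+) g n).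
Proof.
rewrite (star_hom_sum (alpha_hom g)); apply: eq_bigr => a _; rewrite alpha_flip_units.
by case: (g n) => /=; rewrite ?addbT ?addbF.
Qed.

Lemma half_comm (m l : 'I_N) (b c : bool) : m != l -> half m b * half l c = half l c * half m b.
Proof.
move=> ml; by apply: (commutes_copies ml); apply: (in_span_sum (flip_units_mu _ _)) => a _;
  exact: in_span_E.
Qed.

(** Minimal projections of a copy of C((Z/2)^N), and its unit. *)
Definition block h : A := \prod_(m < N) half m (h m).
Definition unit_proj : A := \sum_h block h.
Local Notation p := unit_proj.

Lemma blockM h h' : block h * block h' = if h == h' then block h else 0.
Proof.
rewrite /block prod_ord_mul => [|m l ml]; last exact: half_comm.
have [<-|hh] := eqVneq h h'; first by apply: eq_bigr => m _; rewrite halfM eqxx.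
have [m hm] : exists m, h m != h' m.
  apply: contrapT => H; case/eqP: hh; apply/ffunP => m.
  by apply/eqP; apply: contrapT => /negP hm; apply: H; exists m.
by apply: (@prod_ord_eq0 _ _ _ _ m); rewrite halfM (negPf hm).
Qed.

Lemma block_star h : star (block h) = block h.
Proof.
rewrite prod_ord_star => [|m l ml]; last by rewrite !half_star half_comm.
by apply: eq_bigr => m _; rewrite half_star.
Qed.

Lemma alpha_block g h : alpha g (block h) = block [ffun m => h m (+) g m].
Proof.
rewrite (star_hom_prod (alpha_hom g)); apply: eq_bigr => m _.
by rewrite alpha_half ffunE.
Qed.

Lemma commutes_block z h :
  (forall m Y, commutes_with z (@factor m k Y)) -> commutes_with z (block h).
Proof.
by move=> H; apply: comm_prod => m; apply: commutes_sum => a _; exact: H.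
Qed.

Lemma translate_inj g : injective (fun h : {ffun 'I_N -> bool} => [ffun m => h m (+) g m]).
Proof.
move=> h h' /ffunP H; apply/ffunP => m; have := H m.
by rewrite !ffunE => /addIb.
Qed.

(** The same projection is diagonal in the eigenbasis, since the two bases share
    their fixed vector. *)
Lemma unit_proj_units : p = \sum_(t | ~~ has_fixed t) units t t.
Proof.
rewrite /unit_proj /block -(bigA_distr_bigA (fun (m : 'I_N) (b : bool) => half m b)) /=.
under eq_bigr do rewrite big_bool /= addrC half_sum big_mkcond /=.
rewrite bigA_distr_bigA [RHS]big_mkcond; apply: eq_bigr => t _ /=.
rewrite /has_fixed negb_exists; case: ifPn => [/forallP H|].
  by apply: eq_bigr => m _; rewrite H.
rewrite negb_forall => /existsP[m /negbTE tm].
by apply: (@prod_ord_eq0 _ _ _ _ m); rewrite tm.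
Qed.

Lemma unit_proj_compl : 1 - p = \sum_(t | has_fixed t) units t t.
Proof.
rewrite -(mu_sum HU) (bigID (@has_fixed N (r k.+1))) /= unit_proj_units.
by rewrite addrK.
Qed.

Lemma units_unit_proj s t : ~~ has_fixed t -> units s t * p = units s t.
Proof.
move=> Ht; rewrite unit_proj_units mulr_sumr (bigD1 t) //= (mu_mul HU) eqxx.
rewrite big1 ?addr0 // => u /andP[_ /negPf ut].
by rewrite (mu_mul HU) eq_sym ut.
Qed.

Lemma unit_proj_units0 s t : has_fixed s -> p * units s t = 0.
Proof.
move=> Hs; rewrite unit_proj_units mulr_suml big1 // => u Hu.
by rewrite (mu_mul HU); case: eqP => // us; rewrite us Hs in Hu.
Qed.

Lemma unit_proj_projection : projection p.
Proof.
split; first by rewrite star_sum; apply: eq_bigr => h _; rewrite block_star.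
rewrite mulr_suml; apply: eq_bigr => h _; rewrite mulr_sumr (bigD1 h) //= blockM eqxx.
by rewrite big1 ?addr0 // => h' /negPf hh; rewrite blockM eq_sym hh.
Qed.

Lemma unit_proj_fixed : fixed alpha p.
Proof.
move=> g; rewrite (star_hom_sum (alpha_hom g)); under eq_bigr do rewrite alpha_block.
by rewrite [RHS](reindex_inj (@translate_inj g)).
Qed.

Lemma unit_proj_neq1 : (0 < N)%N -> 1 - p <> 0.
Proof.
move=> N0 p1; pose t0 : Y := [ffun=> None].
have t0f : has_fixed t0 by apply/existsP; exists (Ordinal N0); rewrite ffunE.
apply: (mu_neq0 HU (i := t0) (j := t0)).
have := unit_proj_units0 t0 t0f; move/eqP: p1; rewrite subr_eq0 => /eqP <-.
by rewrite mul1r.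
Qed.

(** The values of f on representatives of the cosets of an open subgroup, as
    coefficients of the corresponding minimal projections. This is a
    star-homomorphism; only its equivariance is approximate. *)
Definition phi (f : contC R Z2prod) : A := \sum_h f (extend h) *: block h.

Lemma phiM f1 f2 : phi (f1 * f2) = phi f1 * phi f2.
Proof.
rewrite diag_mul => [|h h']; last by rewrite blockM.
by apply: eq_bigr => h _.
Qed.

Lemma phi_star f : phi (star f) = star (phi f).
Proof. by rewrite diag_star => [|h]; last exact: block_star. Qed.

Lemma phi1 : phi 1 = p.
Proof. by apply: eq_bigr => h _; exact: scale1r. Qed.

Lemma phi_linear : linear phi.
Proof.
move=> c f1 f2; rewrite scaler_sumr -big_split; apply: eq_bigr => h _ /=.
by rewrite scalerA -scalerDl.
Qed.

(** Complete positivity is inherited from multiplicativity: phi maps Y^* Y to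
    the product of the images of Y^* and Y, entrywise. *)
Lemma phi_ucp : ucp_corner p phi.
Proof.
have corner_phi f : corner p (phi f) by rewrite /corner /= -phi1 -!phiM mul1r mulr1.
split=> //; [exact: phi_linear|exact: phi1|move=> n X [Y _ ->]].
exists (map_mx phi Y); first by move=> a b; rewrite mxE.
have hD : {morph phi : x y / x + y}.
  by move=> x y; have := phi_linear 1 x y; rewrite !scale1r.
have h0 : phi 0 = 0 by apply: (addrI (phi 0)); rewrite -hD !addr0.
apply/matrixP => a b; rewrite !mxE (big_morph _ hD h0); apply: eq_bigr => c _.
by rewrite !mxE phiM phi_star.
Qed.

Lemma phi_norm f (M : R) : 0 <= M -> (forall g, `|f g| <= M%:C) -> cnorm (phi f) <= M.
Proof.
by move=> M0 fM; apply: (cnorm_diag_le blockM block_star) => // h; exact: fM.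
Qed.

Lemma commutes_phi z f :
  (forall m Y, commutes_with z (@factor m k Y)) -> commutes_with z (phi f).
Proof.
by move=> H; apply: commutes_sum => h _; apply: commutesZ; exact: commutes_block.
Qed.

(** Both terms are combinations of the same projections, and their coefficients
    are values of f at points agreeing in the first N coordinates. *)
Lemma phi_equivariant f (e : R) g : 0 <= e ->
  (forall g1 g2 : Z2prod, (forall n, (n < N)%N -> g1 n = g2 n) ->
    `|f g1 - f g2| <= e%:C) ->
  cnorm (phi (Lt g f) - alpha g (phi f)) <= e.
Proof.
move=> e0 fe; have -> : alpha g (phi f) =
    \sum_(h : {ffun 'I_N -> bool}) f (extend [ffun m : 'I_N => h m (+) g m]) *: block h.
  rewrite (star_hom_sum (alpha_hom g)) [RHS](reindex_inj (@translate_inj g)).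
  apply: eq_bigr => h _; rewrite (star_homZ (alpha_hom g)) alpha_block; congr (f (extend _) *: _).
  by apply/ffunP => m; rewrite !ffunE -addbA addbb addbF.
rewrite /phi -sumrB; under eq_bigr do rewrite -scalerBl.
apply: (cnorm_diag_le blockM block_star) => // h; apply: fe => n nN.
rewrite -[n]/(val (Ordinal nN)) extendE ffunE addbC -(extendE h).
by [].
Qed.
End TensorFactors.

(** * Absorbing 1 - p *)

(** The projection 1 - p fits under a line of the matrix algebra E. In ket
    notation v is the sum of |x><xi| (x) |t><f(x,t)| over the basis vectors x of
    E and t of the range of 1 - p. Injectivity of f makes v a partial isometry;
    for v to be fixed, the character of f(x,t) has to be the product of those of
    x, t and xi. The basis vectors outside 1 - p carry arbitrary characters, each
    with multiplicity r(k+1)^N, so the cardinality assumption leaves room for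
    such an f, with all its values orthogonal to 1 - p. *)
Lemma absorb N k (X : finType) (E : X -> X -> A) chi (xi : X -> R[i])
    (kappa : nat -> bool) (p := unit_proj N k) :
  equivariant_units N E chi ->
  (forall n Y x y, commutes_with (@factor n k Y) (E x y)) ->
  unit_vector xi -> (0 < r k.+1)%N ->
  (#|X| * #|@has_fixed N (r k.+1)| <= r k.+1 ^ N)%N ->
  exists v : A, [/\ v * star v = 1 - p, v * line_proj E xi = v,
    v * p = v /\ p * v = 0,
    (forall x m, (m < N)%N -> chi x m != kappa m -> xi x = 0) -> fixed alpha v &
    forall z, (forall n Y, commutes_with z (@factor n k Y)) ->
      (forall x y, commutes_with z (E x y)) -> commutes_with z v].
Proof.
move=> [HE aE] cE x1 r0 card; have [HU aU] := units_equivariant N k.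
pose D := [pred q : X * {ffun 'I_N -> zidx (r k.+1)} | has_fixed q.2].
have [a ainj] : exists a : _ -> {ffun 'I_N -> 'I_(r k.+1)}, {in D &, injective a}.
  apply: injection_on; first exact: [ffun=> Ordinal r0].
  rewrite card_ffun !card_ord; apply: leq_trans card.
  by rewrite (eq_card (B := [predX X & @has_fixed N (r k.+1)])) ?cardX.
(* the character is prescribed, the remaining labels keep f injective *)
pose f (q : X * {ffun 'I_N -> zidx (r k.+1)}) : {ffun 'I_N -> zidx (r k.+1)} :=
  [ffun m : 'I_N => Some (chi q.1 m (+) kappa m (+) parity (q.2 m), a q m)].
have finj : {in D &, injective f}.
  move=> q q' qD q'D /ffunP ff; apply: ainj => //; apply/ffunP => m.
  by have := ff m; rewrite !ffunE => -[].
have fY q : ~~ has_fixed (f q).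
  by rewrite negb_exists; apply/forallP => m; rewrite ffunE.
have braU x (s t : {ffun 'I_N -> zidx (r k.+1)}) : commutes_with (bra E xi x) (units s t).
  apply: commutes_units => n Y; apply/esym; apply: commutes_sum => y _.
  by apply: commutesZ; exact: cE.
have EU x y (s t : {ffun 'I_N -> zidx (r k.+1)}) : commutes_with (E x y) (units s t).
  by apply: commutes_units => n Y; apply/esym; exact: cE.
pose v := \sum_(q | D q) bra E xi q.1 * units q.2 (f q).
have vs : v * star v = 1 - p.
  rewrite unit_proj_compl star_sum mulr_suml.
  transitivity (\sum_(q | D q) E q.1 q.1 * units q.2 q.2).
    apply: eq_bigr => q qD; rewrite mulr_sumr (bigD1 q) //= big1 ?addr0.
      rewrite starM (mu_star HU) mulrA -(mulrA (bra _ _ _)) (mu_mul HU) eqxx.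
      by rewrite braU -mulrA (bra_mul_star HE) // EU.
    move=> q' /andP[q'D /negPf qq]; rewrite starM (mu_star HU) mulrA -(mulrA (bra _ _ _)).
    rewrite (mu_mul HU); case: eqP => [/finj E1|_]; last by rewrite mulr0 mul0r.
    by rewrite E1 ?eqxx in qq.
  rewrite -[RHS]mul1r -(mu_sum HE) mulr_suml.
  under [RHS]eq_bigr do rewrite mulr_sumr.
  by rewrite (pair_big predT (@has_fixed N (r k.+1)) (fun x t => E x x * units t t)).
have vp : v * p = v.
  rewrite mulr_suml; apply: eq_bigr => q qD.
  by rewrite -mulrA units_unit_proj.
have pv : p * v = 0.
  rewrite mulr_sumr big1 // => q qD.
  have pb : p * bra E xi q.1 = bra E xi q.1 * p.
    rewrite /p unit_proj_units; apply/esym; apply: commutes_sum => t _; exact: braU.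
  by rewrite mulrA pb -mulrA unit_proj_units0 ?mulr0.
exists v; split=> //.
- rewrite mulr_suml; apply: eq_bigr => q qD; rewrite -mulrA.
  have -> : units q.2 (f q) * line_proj E xi = line_proj E xi * units q.2 (f q).
    by apply: commutes_combin => x y; apply/esym; exact: EU.
  by rewrite mulrA (bra_line_proj HE).
- move=> xik g; rewrite (star_hom_sum (alpha_hom g)); apply: eq_bigr => q qD.
  have ab x : alpha g (bra E xi x) = (sgn N (chi x) g * sgn N kappa g) *: bra E xi x.
    rewrite (star_hom_sum (alpha_hom g)) scaler_sumr; apply: eq_bigr => y _.
    rewrite (star_homZ (alpha_hom g)) aE !scalerA.
    have [y0|[m [mN ym]]] : (forall m, (m < N)%N -> chi y m = kappa m) \/
        exists m, (m < N)%N /\ chi y m != kappa m.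
      apply: contrapT => /not_orP[H1 H2]; apply: H1 => m mN.
      by apply/eqP; apply: contrapT => /negP ym; apply: H2; exists m.
    + by rewrite (eq_sgn _ y0) mulrC.
    + by rewrite (xik y m mN ym) conj_real !(mul0r, mulr0).
  rewrite (star_homM (alpha_hom g)) ab aU -scalerAl -scalerAr scalerA.
  rewrite [X in X *: _](_ : _ = 1) ?scale1r //.
  have -> : sgn N (parities (f q)) g =
      sgn N (fun m => chi q.1 m (+) kappa m (+) parities q.2 m) g.
    by apply: eq_sgn => m mN; rewrite -[m]/(val (Ordinal mN)) !paritiesE ffunE.
  rewrite !sgnD; set c1 := sgn _ _ _; set c2 := sgn _ _ _; set c3 := sgn _ _ _.
  transitivity ((c1 * c1) * (c2 * c2) * (c3 * c3)); first by ring.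
  by rewrite !sgn_sq !mulr1.
- move=> z zY zE; apply: commutes_sum => q _; apply: commutesM.
    by apply: commutes_sum => x _; apply: commutesZ; exact: zE.
  exact: commutes_units.
Qed.

Lemma level_star N K a : level N K a -> level N K (star a).
Proof.
elim=> [n k X nN kK||b c _ IHb _ IHc|b c _ IHb _ IHc|t b _ IH].
- by rewrite -(star_hom_star (factor_hom n k)); apply: level_gen.
- rewrite star1; exact: level_1.
- rewrite starD; exact: level_add.
- rewrite starM; exact: level_mul.
- rewrite starZc; exact: level_scale.
Qed.

Lemma approx_level a (e : R) : 0 < e -> exists M : nat, forall m, (M <= m)%N ->
  exists b, level m m b /\ cnorm (a - b) < e.
Proof.
move=> e0; have [N [K [b [Lb Hb]]]] := level_dense a e0.
exists (maxn N K) => m; rewrite geq_max => /andP[Nm Km].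
by exists b; split=> //; exact: level_mono Lb.
Qed.

Lemma line_proj_fixed N (X : finType) (E : X -> X -> A) chi (xi : X -> R[i])
    (kappa : nat -> bool) : equivariant_units N E chi ->
  (forall x m, (m < N)%N -> chi x m != kappa m -> xi x = 0) ->
  fixed alpha (line_proj E xi).
Proof.
move=> [HE aE] xik g; rewrite (combin_hom _ (alpha_hom g)).
apply: eq_bigr => x _; apply: eq_bigr => y _; rewrite aE scalerA.
have sgnk z : xi z != 0 -> sgn N (chi z) g = sgn N kappa g.
  move=> z0; apply: eq_sgn => m mN; apply/eqP; apply: contrapT => /negP zm.
  by rewrite (xik z m mN zm) eqxx in z0.
have [->|x0] := eqVneq (xi x) 0; first by rewrite !mul0r.
have [->|y0] := eqVneq (xi y) 0; first by rewrite conj_real !(mulr0, mul0r).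
by rewrite !sgnk // sgn_sq mulr1.
Qed.

(** * The tracial conditions *)

(** The order of the choices matters. The set S fixes the tolerance for F and a
    lower bound for N; the approximants of F, x and y raise N; the resulting
    matrix algebra determines how large the matrix factors of p have to be. The
    bound on phi f must therefore not depend on N. *)
Lemma simultaneous_conditions (F : set A) (S : set (contC R Z2prod)) (eps : R) (x y : A) :
  finite_set F -> finite_set S -> 0 < eps ->
  positive_in setT x -> cnorm x = 1 ->
  positive_in (fixed alpha) y -> y <> 0 ->
  exists (p : A) (phi : contC R Z2prod -> A) (s : A),
    trp_comparison_conditions alpha F S eps x y p phi /\
    strong_modified_trp_conditions alpha F S eps x p phi s.
Proof.
move=> finF finS e0 [bx _ xE] nx [b_y fby yE] y0.
have bx1 : cnorm bx = 1.
  have := cnorm_star bx; rewrite -xE nx => /esym/eqP; rewrite sqrf_eq1.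
  by case/orP => /eqP // H; have := cnorm_ge0 bx; rewrite H; lra.
have by0 : b_y <> 0 by move=> H; apply: y0; rewrite yE H mulr0.
have bx0 : bx <> 0 by move=> H; move: bx1; rewrite H cnorm0; lra.
have [C HC] : exists C : nat, forall f, S f -> forall m, (C <= m)%N ->
    forall g, `|f g| <= m%:R.
  apply: finite_set_uniform finS _ => f _; have [M HM] := contC_bounded f.
  by exists M => m Mm g; apply: le_trans (HM g) _; rewrite ler_nat.
have {}HC f : S f -> forall g, `|f g| <= (C%:R : R)%:C.
  by move=> Sf g; rewrite rmorph_nat; exact: (HC f Sf C (leqnn _) g).
have [N1 HN1] : exists N1 : nat, forall f, S f -> forall m, (N1 <= m)%N ->
    forall g h : Z2prod, (forall n, (n < m)%N -> g n = h n) ->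
    `|f g - f h| <= (eps / 2)%:C.
  apply: finite_set_uniform finS _ => f _.
  have [N HN] := contC_unif f (divr_gt0 e0 (ltr0Sn R 1)).
  by exists N => m Nm g h gh; apply: HN => n nN; apply: gh; exact: leq_trans Nm.
pose d := eps / (4 * (C%:R + 1)).
have C0 : 0 <= C%:R :> R by [].
have d0 : 0 < d by rewrite divr_gt0 // mulr_gt0 //; lra.
have dE : d * (4 * (C%:R + 1)) = eps by rewrite divfK // gt_eqF // mulr_gt0 //; lra.
have [M1 HM1] : exists M1 : nat, forall a, F a -> forall m, (M1 <= m)%N ->
    exists b, level m m b /\ cnorm (a - b) < d.
  by apply: finite_set_uniform finF _ => a _; exact: approx_level.
pose dx := Num.min (8^-1) (eps / 8).
have dx0 : 0 < dx by rewrite lt_min invr_gt0 ltr0n divr_gt0.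
have dx1 : dx <= 8^-1 by rewrite ge_min lexx.
have dx2 : dx <= eps / 8 by rewrite ge_min lexx orbT.
have [M2 HM2] := approx_level bx dx0.
have dy0 : 0 < cnorm b_y / 8 by rewrite divr_gt0 // cnorm_gt0.
have [M3 HM3] := approx_level b_y dy0.
pose N := (maxn (maxn M1 M2) (maxn M3 N1)).+1.
have [NM1 NM2 NM3 NN1] : [/\ M1 <= N, M2 <= N, M3 <= N & N1 <= N]%N.
  by rewrite /N; split; lia.
have [X [E [chi [HE sE cE]]]] := level_units N N.
have HE1 := equ_mu HE.
have [bx' [/sE[cx bxE] bxd]] := HM2 N NM2.
have [by' [/sE[cy' by'E] by'd]] := HM3 N NM3.
have [cy [Hcy cyd]] := average_block_diagonal cy' HE fby.
rewrite -by'E in cyd.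
have [xix [_ [lamx [ux _ lx qx]]]] := @top_line _ _ _ _ HE1 unit (fun=> tt) cx
  (fun i j ij => False_ind _ (elimN eqP ij erefl)).
have [xiy [kap [lamy [uy ky ly qy]]]] := @top_line _ _ _ _ HE1 {ffun 'I_N -> bool}
  (fun z => [ffun m : 'I_N => chi z m]) cy ltac:(
    move=> z t zt; have [m zm] : exists m : 'I_N, chi z m != chi t m;
    [ apply: contrapT => H; case/eqP: zt; apply/ffunP => m; rewrite !ffunE;
      apply/eqP; apply: contrapT => /negP zm; apply: H; by exists m
    | exact: Hcy (ltn_ord m) zm ]).
pose kappa m := if insub m is Some m' then kap m' else false.
have xiyk z m : (m < N)%N -> chi z m != kappa m -> xiy z = 0.
  move=> mN zm; apply: ky; apply: contra zm => /eqP/ffunP/(_ (Ordinal mN)).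
  by rewrite /kappa ffunE (insubT (fun m => m < N)%N mN) => ->.
have [K HK] := power_gap #|X| N.
pose k := maxn N K.
have Nk : (N <= k)%N by rewrite leq_maxl.
have rk : (K <= r k.+1)%N.
  by apply: leq_trans (leq_r _); rewrite leqW // leq_maxr.
have r0 : (0 < r k.+1)%N by apply: leq_trans (leq_r _).
have cardX : (#|X| * #|@has_fixed N (r k.+1)| <= r k.+1 ^ N)%N.
  by rewrite card_has_fixed; exact: HK.
have X0 : (0 < #|X|)%N.
  by have [x0 _] := mu_inhabited HE1; apply/card_gt0P; exists x0.
have card1 : (#|{: unit}| * #|@has_fixed N (r k.+1)| <= r k.+1 ^ N)%N.
  by rewrite card_unit mul1n; apply: leq_trans cardX; rewrite leq_pmull.
have cEk n Y z t : commutes_with (@factor n k Y) (E z t) by exact: cE.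
pose p := unit_proj N k; pose phi0 := @phi N k.
have [vx [vxs vxq [vxp _] _ _]] := absorb (fun=> false) HE cEk ux r0 cardX.
have [vy [vys vyq [vyp _] vyf _]] := absorb kappa HE cEk uy r0 cardX.
have u1 : unit_vector (fun _ : unit => 1 : R[i]).
  by rewrite /unit_vector (big_pred1 tt) => [|[]//]; rewrite conj_real mulr1.
(* absorption under the trivial matrix algebra gives s, as the adjoint of v *)
have [v [vs _ [vp pv] vf vc]] := absorb (fun=> false) (equivariant_unit N)
  (fun n Y _ _ => etrans (mulr1 _) (esym (mul1r _))) u1 r0 card1.
rewrite -/p in vxs vxp vys vyp vs vp pv.
have {}vf : fixed alpha v by apply: vf.
have [ps pp] := unit_proj_projection N k; rewrite -/p in ps pp.
have pf : fixed alpha p := unit_proj_fixed N k.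
have level_k a : level N N a -> forall n Y, commutes_with (@factor n k Y) a.
  move=> La n Y; apply: level_commutes La => n' k' Y' k'N; apply: factor_comm.
  by rewrite xpair_eqE negb_and orbC gtn_eqF // (leq_trans k'N).
have aecm : approx_equivariant_central_mult alpha F S eps phi0.
  split=> [f1 f2 _ _|f a Sf Fa|f Sf].
  - by rewrite /phi0 phiM subrr cnorm0.
  - have [a' [La ad]] := HM1 a Fa N NM1.
    have ca : phi0 f * a' = a' * phi0 f.
      apply/esym; apply: commutes_phi => n Y; apply/esym; exact: level_k.
    have -> : phi0 f * a - a * phi0 f = phi0 f * (a - a') - (a - a') * phi0 f.
      by rewrite mulrBr mulrBl ca opprB addrA subrK.
    have nf : cnorm (phi0 f) <= C%:R by apply: phi_norm => //; exact: HC.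
    have := cnormB (phi0 f * (a - a')) ((a - a') * phi0 f).
    have := cnormM_le nf (ltW ad); have := cnormM_le (ltW ad) nf.
    have := mulr_ge0 (ltW d0) C0; lra.
  - apply: (@le_lt_trans _ _ ((eps / 2)%:E)); last by rewrite lte_fin; lra.
    apply: ge_ereal_sup => _ [g _ <-]; rewrite lee_fin.
    by apply: phi_equivariant; [lra|exact: HN1].
(* no character is prescribed for xix, so the comparison takes place in A *)
have subx : cuntz_sub setT (1 - p) x.
  apply: (@cuntz_sub_comp _ _ _ _ (line_proj E xix) _ vx) => //.
    by rewrite vxq.
  rewrite xE; apply: cuntz_sub_top_line lx qx => //; first exact: line_proj_projection.
  by rewrite -bxE bx1 (le_trans (ltW bxd)) // mul1r.
have suby : cuntz_sub (fixed alpha) (1 - p) y.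
  apply: (@cuntz_sub_comp _ _ _ _ (line_proj E xiy) _ vy).
  - exact: fixed_subalgebra.
  - exact: vyf.
  - by rewrite vyq.
  rewrite yE; apply: cuntz_sub_top_line ly qy => //.
  - exact: fixed_subalgebra.
  - exact: line_proj_projection.
  - exact: line_proj_fixed HE xiyk.
  - by apply: (ssa_mul fixed_subalgebra) => //; apply: (ssa_star fixed_subalgebra).
  - exact: le_trans cyd (ltW by'd).
have subp : cuntz_sub (fixed alpha) (1 - p) p.
  exists (fun=> v) => //; rewrite vp vs subrr cnorm0; exact: cvg_cst.
(* p commutes with q, and p q is a nonzero projection since it carries vx *)
have normp : 1 - eps < cnorm (p * x * p).
  set q := line_proj E xix in qx vxq.
  have pq : projection q by exact: line_proj_projection.
  have [qs qq] := pq.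
  have qp : p * q = q * p.
    apply: commutes_combin => z t; apply/esym; rewrite /p unit_proj_units.
    apply: commutes_sum => s' _; apply: commutes_units => n Y.
    apply/esym; exact: cEk.
  have npq : cnorm (p * q) = 1.
    apply: cnorm_proj; first split.
    - by rewrite starM qs ps qp.
    - by rewrite {2}qp mulrA -(mulrA p) qq -mulrA -qp mulrA pp.
    move=> pq0; apply: (@unit_proj_neq1 N k) => //.
    have vx0 : vx = 0 by rewrite -vxp -vxq -mulrA -qp pq0 mulr0.
    by rewrite -/p -vxs vx0 mul0r.
  have bd : cnorm (bx - bx') < dx by [].
  have n1 := cnorm_le_dist bx bx'; have n2 := cnorm_le_dist bx' bx.
  rewrite bx1 in n1 n2; rewrite (cnormC bx') in n2; rewrite -bxE in lx qx.
  have dist := sqr_norm_dist bx' bx; rewrite -xE bx1 (cnormC bx') in dist.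
  have key : q * (p * x * p) * q =
      lamx%:C *: (p * q) - p * (q * (star bx' * bx' - x) * q) * p.
    have -> : q * (p * x * p) * q = p * (q * x * q) * p.
      by rewrite !mulrA -qp -!mulrA qp.
    rewrite [q * (_ - _)]mulrBr [(_ - _) * q]mulrBl qx mulrBr mulrBl -scalerAr -scalerAl.
    have -> : p * q * p = p * q by rewrite -mulrA -qp mulrA pp.
    by rewrite opprB addrC subrK.
  have := cnorm_compress (p * x * p) pq; rewrite key => H1.
  have := cnorm_le_dist (lamx%:C *: (p * q)) (p * (q * (star bx' * bx' - x) * q) * p).
  have lamx0 : 0 <= lamx by apply: le_trans lx; rewrite exprn_ge0 ?cnorm_ge0.
  rewrite cnormZr npq mulr1 ger0_norm // => H2.
  have H3 : cnorm (p * (q * (star bx' * bx' - x) * q) * p) <= cnorm (star bx' * bx' - x).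
    apply: le_trans (cnorm_compress _ _) _; first by split.
    exact: cnorm_compress.
  have := cnorm_ge0 (bx - bx'); nra.
exists p, phi0, (star v).
have ucp : ucp_corner p phi0 by exact: phi_ucp.
split; split=> //.
- split; last by move=> g; rewrite (star_hom_star (alpha_hom g)) vf.
  by rewrite /partial_isometry starK -mulrA vs mulrBr mulr1 -[star v * p]starK starM starK ps pv star0 subr0.
- rewrite starK; split=> //; rewrite /le_star; exists (p - star v * v) => //.
  rewrite starB starM starK ps mulrBr !mulrBl pp -!mulrA vp.
  have -> : p * (star v * v) = star v * v by rewrite mulrA -ps -starM vp.
  have -> : star v * (v * (star v * v)) = star v * v.
    by rewrite (mulrA v) vs mulrBl mul1r pv subr0.
  by rewrite subrr subr0.
- move=> a Fa; have [a' [La ad]] := HM1 a Fa N NM1.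
  have ca : star v * a' = a' * star v.
    apply: (can_inj (@starK R A)); rewrite !starM starK; apply: vc.
      by move=> n Y; apply/esym; apply: level_k; exact: level_star.
    by move=> _ _; rewrite /commutes_with mulr1 mul1r.
  have -> : star v * a - a * star v = star v * (a - a') - (a - a') * star v.
    by rewrite mulrBr mulrBl ca opprB addrA subrK.
  have nv : cnorm (star v) <= 1.
    have p1 : cnorm (1 - p) <= 1.
      apply: cnorm_proj_le1; split; first by rewrite starB star1 ps.
      by rewrite mulrBr mulr1 mulrBl mul1r pp subrr subr0.
    have := cnorm_star (star v); rewrite starK vs => H; rewrite H in p1.
    by rewrite -(@ler_pXn2r _ 2) ?nnegrE ?cnorm_ge0 // expr1n.
  have := cnormB (star v * (a - a')) ((a - a') * star v).
  have := cnormM_le nv (ltW ad); have := cnormM_le (ltW ad) nv.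
  have := mulr_ge0 (ltW d0) C0; lra.
Qed.

End Setting.

Theorem theorem4p14 (R : realType)
    (B : cstarType R) (iota : forall k : nat, M3 R k.+1 -> B)
    (HB : infinite_tensor_product iota)
    (nu : B -> B) (nu_aut : star_automorphism nu)
    (nu_tensor : is_tensor_map iota (fun k => Ad (w R k.+1)) nu)
    (A : cstarType R) (j : nat -> B -> A)
    (HA : @infinite_tensor_product R (fun=> B) A j)
    (alpha : Z2prod -> A -> A) (alpha_action : continuous_action alpha)
    (alpha_tensor : forall g : Z2prod,
      @is_tensor_map R (fun=> B) A j (fun n => Z2_action nu (g n)) (alpha g)) :
  [/\ tracial_Rokhlin_with_comparison alpha,
      strong_modified_tracial_Rokhlin alpha &
      forall (F : set A) (S : set (contC R Z2prod)) (eps : R) (x y : A),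
        finite_set F -> finite_set S -> 0 < eps ->
        positive_in setT x -> cnorm x = 1 ->
        positive_in (fixed alpha) y -> y <> 0 ->
      exists (p : A) (phi : contC R Z2prod -> A) (s : A),
        trp_comparison_conditions alpha F S eps x y p phi /\
        strong_modified_trp_conditions alpha F S eps x p phi s].
Proof.
have H := simultaneous_conditions HB nu_tensor HA alpha_action nu_aut alpha_tensor.
have fixed1 g : alpha g 1 = 1 by exact: star_hom1 (alpha_hom alpha_action g).
split=> // [F S eps x y finF finS e0 px nx py y0|F S eps x finF finS e0 px nx].
  have [p [phi [s [Htrp _]]]] := H F S eps x y finF finS e0 px nx py y0.
  by exists p, phi.
have py : positive_in (fixed alpha) (1 : A) by exists 1; rewrite ?star1 ?mulr1.
have y0 : (1 : A) <> 0 by apply/eqP/oner_neq0.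
have [p [phi [s [_ Hsm]]]] := H F S eps x 1 finF finS e0 px nx py y0.
by exists s, p, phi.
Qed.
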